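(* Let $T>0$ and let $C_T$ be the space of continuous functions from $[0,T]$ to $\mathbb{R}$. Consider the infinite server queue in the random environment $Z$ described in the context, with number of active jobs $N^{\varepsilon}$, and let $N$ be the limiting process defined there. Let $A^{\varepsilon}(t)=\int_0^tN^{\varepsilon}(s)\,\mathrm{d}s$, $t\in[0,T]$, be the total accumulated input. Then, $\mathbb P_Z$-almost surely, the following limit in law holds in the space $C_T$ as $\varepsilon\to0$: $$A^{\varepsilon}(\cdot)=\int_0^{\cdot}N^{\varepsilon}(s)\,\mathrm{d}s\ \xrightarrow{(\mathrm d)}\ \int_0^{\cdot}N(s)\,\mathrm{d}s .$$
   Context: All random elements live on a probability space $(\Omega,\mathcal F,\mathbb P)$ with expectation $\mathbb E$. Environment. $Z=\{Z_t;\,t\ge 0\}$ is an $\mathbb{R}^d$-valued stochastic process with initial distribution $\rho_0$ and a unique invariant probability measure $\pi$. It is strongly ergodic with rate $\kappa>0$ in the following sense: for the function $\psi$ below there is a finite random variable $C=C_\psi(\omega)>0$ such that, $\mathbb P$-almost surely, for all $t>0$, $\left|\frac1t\int_0^t\psi(Z_u)\,\mathrm{d}u-\bar\psi\right|\le \frac{C}{(1+t)^{\kappa}}$, where $\bar\psi=\int_{\mathbb{R}^d}\psi(z)\,\pi(\mathrm{d}z)$. Quenched probability. $\mathbb{P}_Z(\cdot)=\mathbb{P}(\cdot\mid Z)$ and $\mathbb{E}_Z[\cdot]=\mathbb{E}[\cdot\mid Z]$. ''$\mathbb P_Z$-almost surely, a limit in law holds'' means: for $\mathbb P$-almost every realization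 of $Z$, the laws under $\mathbb P_Z$ converge weakly. Arrivals. $\lambda:\mathbb{R}_+\to\mathbb{R}_+$ and $\psi:\mathbb{R}^d\to\mathbb{R}_+$ are continuous and bounded by a constant $K>0$, and $\psi$ is positive and Lipschitz. For each $\varepsilon>0$, conditionally on $Z$ the arrival times $\{\Gamma_k^{\varepsilon};\,k\ge1\}$ are the points of a Poisson process on $\mathbb{R}_+$ with nonhomogeneous intensity $s\mapsto\lambda(s)\psi(Z_{s/\varepsilon})$. Services. $\nu(s,\mathrm{d}r)$ is a probability kernel from $\mathbb{R}_+$ to $\mathbb{R}_+$. Conditionally on $Z$ and the arrival times, the service times $\{L_k^{\varepsilon};\,k\ge1\}$ are independent and $L_k^{\varepsilon}$ has law $\nu(\Gamma_k^{\varepsilon},\mathrm{d}r)$. The complementary cumulative distribution function $\bar F_s(r)=\int_r^\infty\nu(s,\mathrm{d}\tau)=\nu(s,(r,\infty))$, $r\ge 0$, satisfies, for some $\alpha>0$ and $c>0$: $\bar F_s(r)\le c\,(r^{-\alpha}\wedge 1)$ for all $r,s>0$, and $|\bar F_s(r)-\bar F_t(r)|\le c(1+r)^{-1-\alpha}(t-s)$ for all $0<s<t$ and $r>0$. Queue. $N^{\varepsilon}(t)=\sum_{k\ge1}\mathbf 1_{\{\Gamma_k^{\varepsilon}<t<\Gamma_k^{\varepsilon}+L_k^{\varepsilon}\}}$. Limit. $M=\sum_{k\ge1}\delta_{(\Gamma_k,L_k)}$ is a Poisson point process on $\mathbb{R}_+\times\mathbb{R}_+$ with (deterministic) mean measure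 $\tilde\nu(\mathrm{d}s,\mathrm{d}r)=\bar\psi\,\lambda(s)\,\nu(s,\mathrm{d}r)\,\mathrm{d}s$, and $N(t)=\sum_{k\ge1}\mathbf 1_{\{\Gamma_k<t<\Gamma_k+L_k\}}$; $N$ is independent of $N^{\varepsilon}$. $C_T$ carries the uniform topology. *)

(* Defs.v *)
From HB Require Import structures.
From mathcomp Require Import all_boot all_order all_algebra.
From mathcomp Require Import all_classical all_reals all_analysis measurable_realfun.

Set Implicit Arguments.
Unset Strict Implicit.
Unset Printing Implicit Defensive.
Import Order.TTheory GRing.Theory Num.Theory.
Import numFieldNormedType.Exports.

Local Open Scope classical_set_scope.
Local Open Scope ring_scope.
Local Open Scope ereal_scope.

(* R^d with its Borel sigma-algebra; its norm in the library is the sup norm,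
   which is equivalent to the Euclidean one. *)
Notation borelRd R d := (g_sigma_algebraType (@open 'rV[R]_d)).

(* A generator of sigma(X_i ; i in D). *)
Definition process_events (dO dE : measure_display) (Omega : measurableType dO)
    (E : measurableType dE) (I : Type) (D : set I) (X : I -> Omega -> E) :
    set (set Omega) :=
  \bigcup_(i in D) preimage_set_system setT (X i) measurable.

Definition independent_processes (R : realType) (dO dE dE' : measure_display)
    (Omega : measurableType dO) (E : measurableType dE) (E' : measurableType dE')
    (P : probability Omega R) (I I' : Type) (D : set I) (D' : set I')
    (X : I -> Omega -> E) (Y : I' -> Omega -> E') : Prop :=
  forall A B, <<s process_events D X >> A -> <<s process_events D' Y >> B ->
    P (A `&` B) = P A * P B.

(* PZ w = P ( . | sigma(G)) (w), as a regular version. *)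
Definition regular_conditional_probability (R : realType) (dO : measure_display)
    (Omega : measurableType dO) (P : probability Omega R)
    (G : set (set Omega)) (PZ : Omega -> probability Omega R) : Prop :=
  forall A, measurable A ->
    @measurable_fun _ _ (g_sigma_algebraType G) (\bar R) setT
      (fun w => PZ w A) /\
    (forall B, <<s G >> B -> \int[P]_(w in B) PZ w A = P (A `&` B)).

(* Transition laws: Q t z is the law of Z_t given Z_0 = z.  The Markov property
   is not required. *)
Definition transition_laws (R : realType) (dO : measure_display)
    (Omega : measurableType dO) (d : nat) (P : probability Omega R)
    (Z : R -> Omega -> borelRd R d) (rho0 : probability (borelRd R d) R)
    (Q : R -> R.-pker borelRd R d ~> borelRd R d) : Prop :=
  forall t : R, (0 <= t)%R -> forall A B : set (borelRd R d),
    measurable A -> measurable B ->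
    P (Z 0%R @^-1` A `&` Z t @^-1` B) = \int[rho0]_(z in A) Q t z B.

Definition invariant_law (R : realType) (d : nat)
    (Q : R -> R.-pker borelRd R d ~> borelRd R d)
    (pi : probability (borelRd R d) R) : Prop :=
  forall t : R, (0 <= t)%R -> forall A : set (borelRd R d), measurable A ->
    \int[pi]_z Q t z A = pi A.

Definition unique_invariant_law (R : realType) (d : nat)
    (Q : R -> R.-pker borelRd R d ~> borelRd R d)
    (pi : probability (borelRd R d) R) : Prop :=
  invariant_law Q pi /\
  forall pi' : probability (borelRd R d) R, invariant_law Q pi' ->
    forall A, measurable A -> pi' A = pi A.

Definition mean_under (R : realType) (d : nat) (pi : probability (borelRd R d) R)
    (psi : 'rV[R]_d -> R) : R := (\int[pi]_z psi z)%R.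

Definition strongly_ergodic (R : realType) (dO : measure_display)
    (Omega : measurableType dO) (d : nat) (P : probability Omega R)
    (Z : R -> Omega -> borelRd R d) (pi : probability (borelRd R d) R)
    (psi : 'rV[R]_d -> R) (kappa : R) : Prop :=
  exists C : {RV P >-> R}, (forall w, 0 < C w)%R /\
    {ae P, forall w, forall t : R, (0 < t)%R ->
      (`| t^-1 * (\int[lebesgue_measure]_(u in `[0, t]) psi (Z u w))
          - mean_under pi psi | <= C w / (1 + t) `^ kappa)%R}.

Definition ccdf_ker (R : realType) (nu : R.-pker R ~> R) (s r : R) : R :=
  fine (nu s `]r, +oo[%classic).

(* N B is the random number of points in B.  poisson_pmf is not the right mass
   function at rate 0, while poisson_prob is the Dirac mass at 0 there; its
   second argument is a dummy. *)
Definition poisson_random_measure (R : realType) (dO dE : measure_display)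
    (Omega : measurableType dO) (E : measurableType dE)
    (Q : probability Omega R) (mu : set E -> \bar R)
    (N : set E -> Omega -> \bar R) : Prop :=
  [/\ forall B, measurable B -> mu B < +oo -> forall n : nat,
        Q (N B @^-1` [set n%:R%:E]) = poisson_prob (fine (mu B)) 0 [set n],
      forall B, measurable B -> mu B = +oo -> Q (N B @^-1` [set +oo]) = 1
    & forall (m : nat) (B : 'I_m -> set E) (C : 'I_m -> set (\bar R)),
        (forall i, measurable (B i)) -> trivIset setT B ->
        (forall i, measurable (C i)) ->
        Q (\bigcap_(i in setT) (N (B i) @^-1` C i)) =
        \prod_(i < m) Q (N (B i) @^-1` C i)].

(* Point configurations are enumerated by k : nat, with times in [0, +oo]: there
   may be only finitely many points, and G k w = +oo means that the k-th point
   is absent. *)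
Definition time_count (R : realType) (Omega : Type) (G : nat -> Omega -> \bar R)
    (B : set R) (w : Omega) : \bar R :=
  counting [set k | G k w < +oo /\ B (fine (G k w))].

Definition marked_count (R : realType) (Omega : Type) (G : nat -> Omega -> \bar R)
    (L : nat -> Omega -> R) (B : set (R * R)) (w : Omega) : \bar R :=
  counting [set k | G k w < +oo /\ B (fine (G k w), L k w)].

Definition marked_points (R : realType) (dO : measure_display)
    (Omega : measurableType dO) (G : nat -> Omega -> \bar R)
    (L : nat -> Omega -> R) : Prop :=
  forall k, [/\ measurable_fun setT (G k), measurable_fun setT (L k),
    forall w, 0 <= G k w & forall w, (0 <= L k w)%R].

(* Mean measure on R_+ of the arrivals, for the realization z of Z. *)
Definition arrival_mean (R : realType) (d : nat) (lambda : R -> R)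
    (psi : 'rV[R]_d -> R) (z : R -> 'rV[R]_d) (eps : R) (B : set R) : \bar R :=
  \int[lebesgue_measure]_(s in B `&` `[0%R, +oo[)
    (lambda s * psi (z (s / eps)))%:E.

Definition limit_mean (R : realType) (lambda : R -> R) (nu : R.-pker R ~> R)
    (psibar : R) (B : set (R * R)) : \bar R :=
  \int[lebesgue_measure]_(s in `[0%R, +oo[)
    ((psibar * lambda s)%:E * nu s (xsection B s)).

(* Under Q, given the sigma-algebra of the times (G k)_k, the marks L k of the
   points that are present are independent with laws nu (G k, .). *)
Definition conditional_marks (R : realType) (dO : measure_display)
    (Omega : measurableType dO) (Q : probability Omega R) (nu : R.-pker R ~> R)
    (G : nat -> Omega -> \bar R) (L : nat -> Omega -> R) : Prop :=
  forall (J : seq nat) (B : nat -> set R) (H : set Omega),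
    uniq J -> (forall k, measurable (B k)) -> <<s process_events setT G >> H ->
    Q (H `&` \bigcap_(k in [set` J]) [set w | G k w < +oo /\ B k (L k w)]) =
    \int[Q]_(w in H `&` \bigcap_(k in [set` J]) [set w | G k w < +oo])
      \prod_(k <- J) nu (fine (G k w)) (B k).

Definition active_jobs (R : realType) (Omega : Type) (G : nat -> Omega -> \bar R)
    (L : nat -> Omega -> R) (t : R) (w : Omega) : \bar R :=
  \sum_(0 <= k <oo)
    (\1_[set w' | (G k w' < t%:E < G k w' + (L k w')%:E)%E] w)%:E.

Definition total_input (R : realType) (Omega : Type) (G : nat -> Omega -> \bar R)
    (L : nat -> Omega -> R) (t : R) (w : Omega) : \bar R :=
  \int[lebesgue_measure]_(s in `[0%R, t]) active_jobs G L s w.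

Definition path_of (R : realType) (Omega : Type) (X : R -> Omega -> \bar R)
    (w : Omega) : R -> R := fun t => fine (X t w).

(* C_T, as a subset of the functions R -> R with the topology of uniform
   convergence on [0, T]; that topology does not separate functions that agree
   on [0, T], so the continuous functionals are those of C([0, T]). *)
Definition CT (R : realType) (T : R) : set {uniform` `[0%R, T] -> R} :=
  [set f : R -> R | {within `[0%R, T], continuous f}].
Arguments CT {R} T.

(* The evaluations generate the Borel sigma-algebra of C_T.  Finiteness is stated
   separately because fine maps +oo to 0. *)
Definition random_element_CT (R : realType) (dO : measure_display)
    (Omega : measurableType dO) (T : R) (Q : probability Omega R)
    (X : R -> Omega -> \bar R) : Prop :=
  (forall t, (0 <= t <= T)%R -> measurable_fun setT (X t)) /\
  {ae Q, forall w, (forall t, (0 <= t <= T)%R -> X t w \is a fin_num) /\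
                   CT T (path_of X w)}.

(* E_Q[phi(X)] for X in C_T almost surely: the domain of integration discards
   the null event where the path is not in C_T. *)
Definition expectation_CT (R : realType) (dO : measure_display)
    (Omega : measurableType dO) (T : R) (Q : probability Omega R)
    (X : R -> Omega -> \bar R) (phi : {uniform` `[0%R, T] -> R} -> R) : \bar R :=
  \int[Q]_(w in path_of X @^-1` CT T) (phi (path_of X w))%:E.

(* The law of X eps under Q converges weakly in C_T, as eps -> 0+, to the law
   of Y under Q'. *)
Definition cvg_in_law_CT (R : realType) (dO dO' : measure_display)
    (Omega : measurableType dO) (Omega' : measurableType dO') (T : R)
    (Q : probability Omega R) (X : R -> R -> Omega -> \bar R)
    (Q' : probability Omega' R) (Y : R -> Omega' -> \bar R) : Prop :=
  [/\ forall eps, (0 < eps)%R -> random_element_CT T Q (X eps),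
      random_element_CT T Q' Y
    & forall phi : {uniform` `[0%R, T] -> R} -> R,
        {within CT T, continuous phi} ->
        (exists M : R, forall f, CT T f -> (`|phi f| <= M)%R) ->
        expectation_CT Q (X eps) phi @[eps --> 0%R^'+] -->
        expectation_CT Q' Y phi].

(* Main.v *)
Require Import Defs.
From HB Require Import structures.
From mathcomp Require Import all_boot all_order all_algebra.
From mathcomp Require Import all_classical all_reals all_analysis measurable_realfun.
From mathcomp Require Import ring lra finmap.

Set Implicit Arguments.
Unset Strict Implicit.
Unset Printing Implicit Defensive.
Import Order.TTheory GRing.Theory Num.Theory.
Import numFieldNormedType.Exports.

Local Open Scope classical_set_scope.
Local Open Scope ring_scope.

(** Fix a realization of the environment for which the arrivals are Poisson and
    the ergodic averages converge.  A job that arrives at time g with service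
    time l contributes min((t - g)^+, l) to the input accumulated by time t, so
    the path A is a finite sum of such functions over the points (g, l) with
    g <= T.  Each of them is Lipschitz in (g, l), uniformly in t <= T, and does
    not change when l is replaced by min(l, T).  Hence, if (0, T] is cut into
    short cells and the marks into short cells, all marks beyond T forming one
    cell, the numbers of points in the product cells determine A uniformly on
    [0, T], up to the mesh times the number of points.

    This turns weak convergence in C_T into a statement about finitely many
    probabilities.  With cells short in time, up to a small probability every
    time cell holds at most one point: what remains is one of finitely many
    configurations, which say of each time cell whether it is empty or in which
    mark cell its point lies.  Let E_s be the event that the fast queue is in
    configuration s, E'_s the same event for the limiting queue, and x_s the path
    of s.  For a bounded continuous functional phi, the expectation of phi(A) is
    compared with the sum over s of phi(x_s) times the probability of E'_s, or of
    E_s for the fast queue ([grid_expectation]).  The error is small on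
    the configurations around which phi varies little.  The others form a bad
    event for the limiting queue, whose probability vanishes as the mesh does by
    continuity of phi at the random path ([bad_event_small]).  For a given grid
    the bad configurations are finitely many and the same for both queues, so
    the fast queue meets them with nearly the same probability.

    The probability of a configuration of the limiting queue is a product of
    Poisson weights ([limit_probE]).  For the fast queue only the arrival times
    are Poisson, and the marks are conditionally independent with a law that
    depends on the arrival time; as that law is Lipschitz in time, the probability
    of E_s is the Poisson weight of its times multiplied by the mark probabilities
    taken at one time of each cell, up to an error proportional to the time mesh
    ([config_approx_time]).  The same approximation holds for the limiting queue
    ([cell_weight_approx]), and the errors remain small after summation over the
    configurations when the time mesh is small compared with the mark mesh
    ([sum_time_weight], [fine_time_grid]).  Finally the mean number of fast
    arrivals in a time cell is the integral of lambda(s) psi(Z_{s / eps}), and it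
    converges to the integral of lambda times the mean of psi, because the
    environment averages out over intervals on which lambda is almost constant
    ([cvg_fast_intensity]). *)

(** * Monotonicity of integrals, and numbers of points *)

(** For a nonnegative function, measurable or not, the integral is by definition a
    supremum over the simple functions below it. *)
Lemma ge0_le_integralW d (T : measurableType d) (R : realType)
    (mu : {measure set T -> \bar R}) (D : set T) (f g : T -> \bar R) :
  (forall x, D x -> 0 <= f x)%E -> (forall x, D x -> f x <= g x)%E ->
  (\int[mu]_(x in D) f x <= \int[mu]_(x in D) g x)%E.
Proof.
move=> f0 fg; rewrite !ge0_integralE//; last first.
  by move=> x Dx; rewrite (le_trans (f0 x Dx))// fg.
apply: le_ereal_sup => _ [h hf <-]; exists h => // x.
apply: le_trans (hf x) _; rewrite /patch; case: ifPn => // /set_mem; exact: fg.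
Qed.

(** With this, the expectation of a functional of the path is bracketed between
    integrals of simple functions, on a domain that need not be an event. *)
Lemma le_integralW d (T : measurableType d) (R : realType)
    (mu : {measure set T -> \bar R}) (D : set T) (f g : T -> \bar R) :
  (forall x, D x -> f x <= g x)%E ->
  (\int[mu]_(x in D) f x <= \int[mu]_(x in D) g x)%E.
Proof.
move=> fg; rewrite [leLHS]integralE [leRHS]integralE; apply: leeB;
  apply: ge0_le_integralW => x Dx.
- exact: funepos_ge0.
- rewrite !funeposE ge_max !le_max lexx orbT andbT.
  by apply/orP; left; exact: fg.
- exact: funeneg_ge0.
- rewrite !funenegE ge_max !le_max lexx orbT andbT.
  by apply/orP; left; rewrite leeN2; exact: fg.
Qed.

Lemma counting_eq0 (R : realType) (A : set nat) :
  (counting A = 0 :> \bar R)%E <-> A = set0.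
Proof.
rewrite /counting; split=> [|->]; last first.
  by rewrite asboolT ?fset_set0//; exact: finite_set0.
case: asboolP => // finA [] /eqP; rewrite pnatr_eq0 cardfs_eq0 => /eqP.
exact: fset_set_set0.
Qed.

Lemma counting_eq1 (R : realType) (A : set nat) :
  (counting A = 1 :> \bar R)%E <-> exists k, A = [set k].
Proof.
rewrite /counting; split=> [|[k ->]]; last first.
  by rewrite asboolT ?fset_set1 ?cardfs1//; exact: finite_set1.
case: asboolP => // finA [] /eqP; rewrite pnatr_eq1 => /cardfs1P[k Ak].
exists k; rewrite -(fset_setK finA) Ak.
by apply/seteqP; split => x /=; rewrite inE => /eqP.
Qed.

Lemma counting_lty (R : realType) (A : set nat) :
  (counting A < +oo :> \bar R)%E <-> finite_set A.
Proof.
by rewrite /counting; case: asboolP => // finA; split => // _; rewrite ltry.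
Qed.

(** * Poisson random measures on finitely many sets *)

Lemma measurable_counting d (T : measurableType d) (R : realType)
    (A : nat -> set T) : (forall k, measurable (A k)) ->
  measurable_fun setT (fun w => counting [set k | A k w] : \bar R).
Proof.
move=> mA; rewrite (_ : (fun _ => _) =
    fun w => (\sum_(0 <= k <oo) (\1_(A k) w)%:E)%E); last first.
  apply/funext => w; rewrite counting_dirac; apply: eq_eseriesr => k _.
  by rewrite diracE indicE.
apply: ge0_emeasurable_sum => [k w _ _|k _]; first by rewrite lee_fin.
exact/measurable_EFinP.
Qed.

Lemma measurable_point_in d (T : measurableType d) (R : realType)
    (G : T -> \bar R) (B : set R) :
  measurable_fun setT G -> measurable B ->
  measurable [set w | (G w < +oo)%E /\ B (fine (G w))].
Proof.
move=> mG mB; apply: measurableI.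
  by rewrite -[X in measurable X]setTI; exact: emeasurable_fun_infty_o.
rewrite -[X in measurable X]setTI.
exact: (measurableT_comp (fine_measurable measurableT) mG).
Qed.

Lemma measurable_time_count d (T : measurableType d) (R : realType)
    (G : nat -> T -> \bar R) (B : set R) :
  (forall k, measurable_fun setT (G k)) -> measurable B ->
  measurable_fun setT (time_count G B).
Proof.
by move=> mG mB; apply: measurable_counting => k; exact: measurable_point_in.
Qed.

Lemma measurable_marked_count d (T : measurableType d) (R : realType)
    (G : nat -> T -> \bar R) (L : nat -> T -> R) (B : set (R * R)) :
  (forall k, measurable_fun setT (G k)) ->
  (forall k, measurable_fun setT (L k)) -> measurable B ->
  measurable_fun setT (marked_count G L B).
Proof.
move=> mG mL mB; apply: measurable_counting => k; apply: measurableI.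
  by rewrite -[X in measurable X]setTI; exact: emeasurable_fun_infty_o.
rewrite -[X in measurable X]setTI.
have mf : measurable_fun setT (fun w => (fine (G k w), L k w)).
  apply: measurable_fun_pair => //.
  exact: (measurableT_comp (fine_measurable measurableT)).
exact: mf.
Qed.

(** Poisson mass at 0 or 1, by a formula that is also right at rate 0. *)
Definition poisson01 (R : realType) (r : R) (b : bool) : R :=
  expR (- r) * r ^+ b.

Lemma poisson_prob01 (R : realType) (r : R) (b : bool) : 0 <= r ->
  poisson_prob r 0 [set (b : nat)] = (poisson01 r b)%:E.
Proof.
rewrite le_eqVlt /poisson_prob /poisson01 => /predU1P[<-|r0].
  rewrite ltxx oppr0 expR0 mul1r diracE; case: b; rewrite ?expr0 ?expr1.
    by rewrite memNset.
  by rewrite mem_set.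
rewrite r0 esum_set1 ?lee_fin ?poisson_pmf_ge0// /poisson_pmf r0.
by case: b; rewrite /= ?fact0 ?factS ?muln1 ?invr1 mulr1 mulrC.
Qed.

(** Enumerating S turns the product rule for families indexed by ordinals into one
    for the pairs of cells of a grid; configurations have counts 0 and 1 only. *)
Lemma poisson_config (R : realType) (dO dE : measure_display)
    (Omega : measurableType dO) (E : measurableType dE)
    (Q : probability Omega R) (mu : set E -> \bar R)
    (N : set E -> Omega -> \bar R) (S : finType) (B : S -> set E)
    (b : S -> bool) :
  poisson_random_measure Q mu N -> (forall s, measurable (B s)) ->
  (forall s, mu (B s) \is a fin_num) -> (forall s, 0 <= mu (B s))%E ->
  trivIset setT B ->
  Q [set w | forall s, N (B s) w = (b s)%:R%:E] =
  (\prod_s poisson01 (fine (mu (B s))) (b s))%:E.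
Proof.
move=> [Npois _ Nind] mB Bfin B0 tB.
pose B' (i : 'I_#|S|) := B (enum_val i).
pose C' (i : 'I_#|S|) : set (\bar R) := [set (b (enum_val i))%:R%:E].
have := Nind #|S| B' C' (fun i => mB _).
have tB' : trivIset setT B'.
  move=> i j _ _ ij; apply: enum_val_inj; exact: tB ij.
have mC' i : measurable (C' i) by exact: emeasurable_set1.
move=> /(_ tB' mC') Nprod; rewrite (_ : [set w | _] =
    \bigcap_(i in setT) (N (B' i) @^-1` C' i)); last first.
  apply/seteqP; split => w /= h; first by move=> i _; exact: h.
  by move=> s; have := h (enum_rank s) I; rewrite /= /C' /B' enum_rankK.
rewrite Nprod (reindex _ (onW_bij _ (enum_val_bij S)))/= -prodEFin.
apply: eq_bigr => i _; rewrite /B' /C'.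
rewrite Npois//; last by rewrite ltey_eq Bfin.
by rewrite poisson_prob01// fine_ge0.
Qed.

Lemma poisson_finite (R : realType) (dO dE : measure_display)
    (Omega : measurableType dO) (E : measurableType dE)
    (Q : probability Omega R) (mu : set E -> \bar R)
    (N : set E -> Omega -> \bar R) (B : set E) :
  poisson_random_measure Q mu N -> measurable B -> (mu B < +oo)%E ->
  measurable_fun setT (N B) ->
  Q [set w | exists n : nat, N B w = n%:R%:E] = 1%E.
Proof.
move=> [Npois _ _] mB Bfin mN.
pose F n := N B @^-1` [set n%:R%:E].
have mF n : measurable (F n).
  by rewrite -[F n]setTI; apply: mN => //; exact: emeasurable_set1.
have tF : trivIset setT F.
  move=> i j _ _ [w []]; rewrite /F /preimage /= => -> [/eqP].
  by rewrite eqr_nat => /eqP.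
rewrite (_ : [set w | _] = \bigcup_n F n); last first.
  by apply/seteqP; split => [w [n]|w [n _]] ?; exists n.
rewrite measure_bigcup//; rewrite (eq_eseriesr (fun n _ => Npois B mB Bfin n)).
transitivity (poisson_prob (fine (mu B)) 0 (\bigcup_n [set n])).
  by rewrite measure_bigcup// => i j _ _ [n [/= -> ->]].
by rewrite (_ : \bigcup_n _ = setT) ?probability_setT// -subTset => n _; exists n.
Qed.

(** * Countable partitions and finite products *)

Lemma measurable_forall_fin d (T : measurableType d) (I : finType)
    (A : I -> set T) : (forall i, measurable (A i)) ->
  measurable [set w | forall i, A i w].
Proof.
move=> mA; rewrite (_ : [set w | _] = \bigcap_(i in [set: I]) A i); last first.
  by apply/seteqP; split => w /= h i; [move=> _; exact: h|exact: h].
exact: fin_bigcap_measurable.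
Qed.

(** Estimates on the pieces of a countable partition add up: the pieces will be
    the events that given indices carry the points of a configuration. *)
Lemma partition_approx d (T : measurableType d) (R : realType)
    (Q : probability T R) (A B : set T) (F : nat -> set T) (p eta : R) :
  measurable A -> measurable B -> (forall n, measurable (F n)) ->
  trivIset setT F -> A `<=` \bigcup_n F n -> B `<=` \bigcup_n F n ->
  0 <= p -> 0 <= eta ->
  (forall n, Q (A `&` F n) <= (p + eta)%:E * Q (B `&` F n))%E ->
  (forall n, p%:E * Q (B `&` F n) <= Q (A `&` F n) + eta%:E * Q (B `&` F n))%E ->
  `|fine (Q A) - p * fine (Q B)| <= eta * fine (Q B).
Proof.
move=> mA mB mF tF AF BF p0 eta0 le1 le2.
have sumF C : measurable C -> C `<=` \bigcup_n F n ->
    (Q C = \sum_(0 <= n <oo) Q (C `&` F n))%E.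
  move=> mC CF; have {1}-> : C = \bigcup_n (C `&` F n).
    by rewrite -setI_bigcupr; apply/esym/setIidPl.
  rewrite measure_bigcup//; first by apply: eq_eseriesl => n; exact: mem_set.
  - by move=> n _; exact: measurableI.
  - by apply: trivIset_setIl.
have QA := sumF _ mA AF; have QB := sumF _ mB BF.
have {}le1 : (Q A <= (p + eta)%:E * Q B)%E.
  rewrite QA QB -nneseriesZl//; exact: lee_nneseries.
have {}le2 : (p%:E * Q B <= Q A + eta%:E * Q B)%E.
  rewrite QA QB -!nneseriesZl// -nneseriesD//; last first.
    by move=> n _ _; rewrite mule_ge0.
  by apply: lee_nneseries => // n _ _; rewrite mule_ge0.
have finQ C : measurable C -> exists q : R, Q C = q%:E.
  by move=> mC; exists (fine (Q C)); rewrite fineK// fin_num_measure.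
move: le1 le2; have [a ->] := finQ _ mA; have [b ->] := finQ _ mB.
rewrite -!EFinM -EFinD !lee_fin /= => le1 le2.
by rewrite ler_norml; apply/andP; split; lra.
Qed.

(** Telescoping: the factors are exchanged one at a time, the others being at
    most 1. *)
Lemma dist_prod_le (R : realFieldType) (I : finType) (x y e : I -> R) :
  (forall i, 0 <= x i <= 1) -> (forall i, 0 <= y i <= 1) ->
  (forall i, `|x i - y i| <= e i) ->
  `|\prod_i x i - \prod_i y i| <= \sum_i e i.
Proof.
move=> x01 y01 xye.
suff : [/\ 0 <= \prod_i x i <= 1, 0 <= \prod_i y i <= 1 &
   `|\prod_i x i - \prod_i y i| <= \sum_i e i] by case.
elim/big_rec3 : _ => [|i w v u _ [u01 v01 uvw]].
  by rewrite subrr normr0 ler01 lexx.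
move: (x01 i) (y01 i) u01 v01 => /andP[? ?] /andP[? ?] /andP[? ?] /andP[? ?].
split.
- by rewrite mulr_ge0//= mulr_ile1.
- by rewrite mulr_ge0//= mulr_ile1.
rewrite (_ : x i * u - y i * v = (x i - y i) * u + y i * (u - v)); last by ring.
rewrite (le_trans (ler_normD _ _))// !normrM lerD//.
  by rewrite (le_trans _ (xye i))// ler_piMr// ger0_norm.
by rewrite (le_trans _ uvw)// ler_piMl// ger0_norm.
Qed.

(** * Configurations: at most one point in each time cell *)

Section configurations.
Context (R : realType) (dO : measure_display) (Omega : measurableType dO).
Context (I J : finType) (cI : I -> set R) (cJ : J -> set R).
Hypotheses (mcI : forall i, measurable (cI i))
           (mcJ : forall j, measurable (cJ j)).
Hypotheses (tcJ : trivIset setT cJ)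
           (covJ : forall l, exists j, cJ j l).
Context (G : nat -> Omega -> \bar R) (L : nat -> Omega -> R).
Hypothesis ptsGL : marked_points G L.
Implicit Types (sigma : {ffun I -> option J}).

Definition hits (k : nat) (i : I) : set Omega :=
  [set w | (G k w < +oo)%E /\ cI i (fine (G k w))].

(** A configuration sigma is None on the empty time cells and Some j on those
    that hold exactly one point, with its mark in cell j; here only the times are
    looked at. *)
Definition time_config sigma : set Omega :=
  [set w | forall i, time_count G (cI i) w = (isSome (sigma i))%:R%:E].

Definition config sigma : set Omega :=
  [set w | forall ij : I * J,
    marked_count G L (cI ij.1 `*` cJ ij.2) w = (sigma ij.1 == Some ij.2)%:R%:E].

Let count01L (A : set nat) (b : bool) : counting A = b%:R%:E :> \bar R ->
  if b then exists k, A = [set k] else A = set0.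
Proof. by case: b => [/counting_eq1|/counting_eq0]. Qed.

Let count01R (A : set nat) (b : bool) :
  (if b then exists k, A = [set k] else A = set0) ->
  counting A = b%:R%:E :> \bar R.
Proof. by case: b => [/counting_eq1|/counting_eq0]. Qed.

Lemma time_configP sigma w : time_config sigma w <->
  forall i, if sigma i is Some _ then exists k, [set k | hits k i w] = [set k]
            else forall k, ~ hits k i w.
Proof.
split=> h i; have := h i; rewrite /time_count.
  move/count01L; case: (sigma i) => //= A0 k hk.
  by have : [set k | hits k i w] k by []; rewrite A0.
case: (sigma i) => [j|] h'; apply: count01R => //.
by apply/seteqP; split => // k; exact: h'.
Qed.

(** Since the mark cells cover the line and are disjoint, the counts of the
    product cells say the same as the number of points in each time cell together
    with the mark cell of the points present. *)
Lemma configP sigma w : config sigma w <->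
  time_config sigma w /\
  forall i j k, sigma i = Some j -> hits k i w -> cJ j (L k w).
Proof.
split.
  rewrite /config /marked_count => h; split.
    apply/time_configP => i; case E : (sigma i) => [j|].
      have /= := h (i, j); rewrite E eqxx => /count01L[k0 k0E]; exists k0.
      apply/seteqP; split=> k; last first.
        move=> /= ->; have : [set k0] k0 by [].
        by rewrite -k0E => -[? []].
      move=> hk; have [j' Lj'] := covJ (L k w).
      suff : [set k0] k by [].
      have [jj'|jj'] := eqVneq j j'.
        by rewrite -k0E; case: hk => ? ?; split => //; split => //=; rewrite jj'.
      have /= := h (i, j'); rewrite E (inj_eq (@Some_inj _)) (negbTE jj') => /count01L.
      by move=> /seteqP[/(_ k)] []; case: hk.
    move=> k hk; have [j Lj] := covJ (L k w).
    have /= := h (i, j); rewrite E => /count01L.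
    by move=> /seteqP[/(_ k)] []; case: hk.
  move=> i j k E hk; have [j' Lj'] := covJ (L k w).
  have [->//|jj'] := eqVneq j j'.
  have /= := h (i, j'); rewrite E (inj_eq (@Some_inj _)) (negbTE jj') => /count01L.
  by move=> /seteqP[/(_ k)] []; case: hk.
move=> [/time_configP th hL] [i j] /=; have := th i.
case E : (sigma i) => [j'|] h; rewrite /marked_count; apply: count01R; last first.
  by apply/seteqP; split => // k [? [? ?]]; exact: (h k).
rewrite (inj_eq (@Some_inj _)); case: eqVneq => [jj'|jj'].
  have [k0 k0E] := h; exists k0; rewrite -k0E.
  apply/seteqP; split => k /=; first by move=> [? []].
  by move=> hk; have := hL _ _ _ E hk; case: hk => ? ?; rewrite jj'.
apply/seteqP; split => // k [Gk [/= Ik Jk]]; have hk : hits k i w by [].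
have := hL _ _ _ E hk => Jk'.
by have := @tcJ j j' Logic.I Logic.I (ex_intro _ _ (conj Jk Jk')); move/eqP: jj' => + /esym.
Qed.

Lemma measurable_config sigma : measurable (config sigma).
Proof.
apply: (@measurable_forall_fin _ _ (I * J)%type (fun ij => [set w |
  marked_count G L (cI ij.1 `*` cJ ij.2) w = (sigma ij.1 == Some ij.2)%:R%:E])).
move=> ij; rewrite -[X in measurable X]setTI.
have mM : measurable_fun setT (marked_count G L (cI ij.1 `*` cJ ij.2)).
  apply: measurable_marked_count; last exact: measurableX.
    by move=> k; case: (ptsGL k).
  by move=> k; case: (ptsGL k).
exact: (mM measurableT [set (sigma ij.1 == Some ij.2)%:R%:E]).
Qed.

Lemma config_sub sigma : config sigma `<=` time_config sigma.
Proof. by move=> w /configP[]. Qed.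

Lemma config_inj sigma sigma' w : config sigma w -> config sigma' w -> sigma = sigma'.
Proof.
move=> h h'; apply/ffunP => i.
case E : (sigma i) => [j|]; case E' : (sigma' i) => [j'|] //.
- have := h (i, j); rewrite (h' (i, j)) /= E E' eqxx (inj_eq (@Some_inj _)).
  by case: eqVneq => [->|]//= _ [] /eqP; rewrite eq_sym oner_eq0.
- by have := h (i, j); rewrite (h' (i, j)) /= E E' eqxx => -[] /eqP; rewrite eq_sym oner_eq0.
- by have := h' (i, j'); rewrite (h (i, j')) /= E E' eqxx => -[] /eqP; rewrite eq_sym oner_eq0.
Qed.

End configurations.

(** * Probability of a configuration when the marks are conditionally independent *)

Lemma pker_le1 d d' (X : measurableType d) (Y : measurableType d')
    (R : realType) (nu : R.-pker X ~> Y) x (B : set Y) : measurable B ->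
  (nu x B <= 1)%E.
Proof.
move=> mB; rewrite -(@prob_kernel _ _ _ _ _ nu x).
by apply: le_measure => //; apply: mem_set.
Qed.

Lemma pker_fin d d' (X : measurableType d) (Y : measurableType d')
    (R : realType) (nu : R.-pker X ~> Y) x (B : set Y) : measurable B ->
  nu x B \is a fin_num.
Proof.
move=> mB; rewrite ge0_fin_numE//.
by rewrite (le_lt_trans (pker_le1 nu x mB))// ltry.
Qed.

Lemma pker01 d d' (X : measurableType d) (Y : measurableType d')
    (R : realType) (nu : R.-pker X ~> Y) x (B : set Y) : measurable B ->
  0 <= fine (nu x B) <= 1.
Proof.
move=> mB; rewrite fine_ge0//= -lee_fin fineK ?pker_fin//; exact: pker_le1.
Qed.

Section conditional_configurations.
Context (R : realType) (dO : measure_display) (Omega : measurableType dO).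
Context (I J : finType) (cI : I -> set R) (cJ : J -> set R).
Hypotheses (mcI : forall i, measurable (cI i)) (tcI : trivIset setT cI).
Hypotheses (mcJ : forall j, measurable (cJ j)) (tcJ : trivIset setT cJ)
           (covJ : forall l, exists j, cJ j l).
Context (G : nat -> Omega -> \bar R) (L : nat -> Omega -> R).
Hypothesis ptsGL : marked_points G L.
Context (Q : probability Omega R) (nu : R.-pker R ~> R).
Hypothesis Qmarks : conditional_marks Q nu G L.
Context (p : I -> J -> R) (eta : R).
Hypotheses (p01 : forall i j, 0 <= p i j <= 1) (eta_ge0 : 0 <= eta).
Hypothesis nup : forall i j s, 0 <= s -> cI i s ->
  `|fine (nu s (cJ j)) - p i j| <= eta.

Definition mark_weight (q : J -> R) (o : option J) : R :=
  if o is Some j then q j else 1.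

Context (sigma : {ffun I -> option J}).

(** The label kappa i is the index of the point in cell i.  It is set to 0 on the
    empty cells, so that a configuration of times has exactly one labelling. *)
Definition labelled (kappa : {ffun I -> nat}) : set Omega :=
  [set w | time_config cI G sigma w /\
    forall i, if sigma i is Some _ then hits cI G (kappa i) i w
              else kappa i = 0%N].

Let SG := process_events setT G.

Let mGS k : measurable_fun (setT : set (g_sigma_algebraType SG)) (G k).
Proof.
move=> _ B mB; rewrite setTI; apply: sub_sigma_algebra.
by exists k => //; exists B => //; rewrite setTI.
Qed.

(** The labelling depends on the arrival times only, so the law of the marks given
    the times applies on this event. *)
Lemma labelled_times kappa : <<s SG >> (labelled kappa).
Proof.
rewrite -[<<s SG >> _]/(measurable (labelled kappa : set (g_sigma_algebraType SG))).
apply: measurableI.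
  apply: (@measurable_forall_fin _ (g_sigma_algebraType SG) _ (fun i => [set w |
    time_count G (cI i) w = (isSome (sigma i))%:R%:E])) => i.
  have mM := measurable_time_count mGS (mcI i).
  rewrite -[X in measurable X]setTI.
  exact: (mM measurableT [set (isSome (sigma i))%:R%:E]).
apply: (@measurable_forall_fin _ (g_sigma_algebraType SG) _ (fun i => [set w |
    if sigma i is Some _ then hits cI G (kappa i) i w else kappa i = 0%N])) => i.
case: (sigma i) => [_|]; first exact: measurable_point_in.
have [->|k0] := eqVneq (kappa i) 0%N.
  by rewrite (_ : [set _ | _] = setT)//; apply/seteqP; split.
by rewrite (_ : [set _ | _] = set0)// -subset0 => w /= /eqP; rewrite (negbTE k0).
Qed.

Lemma measurable_labelled kappa : measurable (labelled kappa).
Proof.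
have := labelled_times kappa.
apply: smallest_sub; first exact: sigma_algebra_measurable.
move=> A [k _ [B mB <-]]; case: (ptsGL k) => mG _ _ _; exact: mG.
Qed.

Lemma labelled_inj kappa kappa' w :
  labelled kappa w -> labelled kappa' w -> kappa = kappa'.
Proof.
move=> [/time_configP th h] [_ h']; apply/ffunP => i.
have := h i; have := h' i; have := th i; case: (sigma i) => [_|_ -> -> //].
move=> [k0 k0E] hk hk'.
have : [set k0] (kappa i) by rewrite -k0E.
have : [set k0] (kappa' i) by rewrite -k0E.
by move=> -> ->.
Qed.

Lemma time_config_labelled w : time_config cI G sigma w ->
  exists kappa, labelled kappa w.
Proof.
move=> tw; have /time_configP h := tw.
have /choice[kappa hk] : forall i, exists k,
    if sigma i is Some _ then hits cI G k i w else k = 0%N.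
  move=> i; have := h i; case: (sigma i) => [_ [k kE]|_]; last by exists 0%N.
  by exists k; have : [set k] k by []; rewrite -kE.
by exists [ffun i => kappa i]; split => // i; rewrite ffunE; exact: hk.
Qed.

(** Once the indices of the points are known, the event is an intersection of
    finitely many conditions on marks, to which conditional independence applies. *)
Lemma labelled_marks kappa :
  Q (config cI cJ G L sigma `&` labelled kappa) =
  (\int[Q]_(w in labelled kappa) (\prod_i
    mark_weight (fun j => fine (nu (fine (G (kappa i) w)) (cJ j))) (sigma i))%:E)%E.
Proof.
have [[w0 [tw0 hw0]]|ne] := pselect (exists w, labelled kappa w); last first.
  have -> : labelled kappa = set0.
    by apply/seteqP; split => // w hw; apply: ne; exists w.
  by rewrite setI0 measure0 integral_set0.
have kinj : {in [pred i | isSome (sigma i)] &, injective kappa}.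
  move=> i i'; rewrite !inE => si si' kk'.
  have := hw0 i; have := hw0 i'; case: (sigma i) si => // j _; case: (sigma i') si' => // j' _.
  rewrite kk' => -[_ h'] [_ h]; apply: (@tcI i i') => //.
  by exists (fine (G (kappa i') w0)).
pose js := [seq kappa i | i <- index_enum I & isSome (sigma i)].
(* kappa is injective on the occupied cells, so the index k determines the cell
   whose mark condition it carries *)
pose B k : set R := if [pick i | isSome (sigma i) && (kappa i == k)] is Some i
  then (if sigma i is Some j then cJ j else setT) else setT.
have Bk i j : sigma i = Some j -> B (kappa i) = cJ j.
  move=> sij; rewrite /B; case: pickP => [i' /andP[si' /eqP kk']|/(_ i)]; last first.
    by rewrite sij eqxx.
  by rewrite (_ : i' = i) ?sij//; apply: kinj; rewrite ?inE ?sij.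
have mB k : measurable (B k).
  rewrite /B; case: pickP => [i _|_]; last exact: measurableT.
  by case: (sigma i).
have ujs : uniq js.
  rewrite map_inj_in_uniq ?filter_uniq ?index_enum_uniq// => i i'.
  by rewrite !mem_filter => /andP[? _] /andP[? _]; apply: kinj; rewrite inE.
have jsP k : k \in js -> exists i j, k = kappa i /\ sigma i = Some j.
  move=> /mapP[i]; rewrite mem_filter => /andP[si _] ->; exists i.
  by case: (sigma i) si => // j _; exists j.
have := Qmarks ujs mB (labelled_times kappa).
rewrite (_ : labelled kappa `&` _ = config cI cJ G L sigma `&` labelled kappa); last first.
  rewrite setIC; apply/seteqP; split => w [hb lw]; split => //.
    apply/(configP _ tcJ covJ); have [tw hw] := lw; split => // i j k sij hk.
    have kk : k = kappa i.
      have /time_configP/(_ i) := tw; have := hw i; rewrite sij => hk' [k0 k0E].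
      have : [set k0] k by rewrite -k0E.
      have : [set k0] (kappa i) by rewrite -k0E.
      by move=> -> ->.
    have /hb[_] : kappa i \in js by apply/mapP; exists i; rewrite // mem_filter sij mem_index_enum.
    by rewrite (Bk _ _ sij) kk.
  move=> k /jsP[i [j [-> sij]]]; have [_ /(_ i)] := lw; rewrite sij => hk.
  split; first by case: hk.
  rewrite (Bk _ _ sij); have /(configP _ tcJ covJ)[_ h] := hb.
  exact: (h i).
move=> ->; rewrite (_ : labelled kappa `&` _ = labelled kappa); last first.
  apply/setIidPl => w [_ hw] k /jsP[i [j [-> sij]]].
  by have := hw i; rewrite sij => -[].
apply: eq_integral => w _; rewrite /js big_map big_filter big_mkcond/=.
rewrite -prodEFin; apply: eq_bigr => i _; case sij : (sigma i) => [j|] //=.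
by rewrite (Bk _ _ sij) fineK// pker_fin.
Qed.

Let n_pts := \sum_i (isSome (sigma i))%:R : R.
Let pw := \prod_i mark_weight (p i) (sigma i).

(** On every labelled event the conditional probability of the marks is a product
    of values of the kernel at the arrival times, each within eta of its value at
    a fixed time of the cell.  The labelled events form a countable partition. *)
Lemma config_approx_time :
  `|fine (Q (config cI cJ G L sigma)) - pw * fine (Q (time_config cI G sigma))|
  <= eta * n_pts * fine (Q (time_config cI G sigma)).
Proof.
pose F n := if @pickle_inv {ffun I -> nat} n is Some kappa then labelled kappa
            else set0.
have weight01 q o : (forall j, 0 <= q j <= 1) -> 0 <= mark_weight q o <= 1.
  by case: o => [j|] //= _; rewrite ler01 lexx.
have n_ge0 : 0 <= n_pts by apply: sumr_ge0.
have coverF : time_config cI G sigma `<=` \bigcup_n F n.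
  move=> w /time_config_labelled[kappa lw]; exists (choice.pickle kappa) => //.
  by rewrite /F pickleK_inv.
have mtime : measurable (time_config cI G sigma).
  apply: (@measurable_forall_fin _ _ _ (fun i => [set w |
    time_count G (cI i) w = (isSome (sigma i))%:R%:E])) => i.
  have mM : measurable_fun setT (time_count G (cI i)).
    by apply: measurable_time_count => // k; case: (ptsGL k).
  rewrite -[X in measurable X]setTI.
  exact: (mM measurableT [set (isSome (sigma i))%:R%:E]).
have key kappa :
    let e := eta * n_pts in
    (Q (config cI cJ G L sigma `&` labelled kappa) <=
       (pw + e)%:E * Q (labelled kappa))%E /\
    (pw%:E * Q (labelled kappa) <=
       Q (config cI cJ G L sigma `&` labelled kappa) + e%:E * Q (labelled kappa))%E.
  have mlab := measurable_labelled kappa.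
  have dist w : labelled kappa w -> `|(\prod_i
      mark_weight (fun j => fine (nu (fine (G (kappa i) w)) (cJ j))) (sigma i))
      - pw| <= eta * n_pts.
    move=> [_ hw]; rewrite mulr_sumr; apply: dist_prod_le => i.
    - by apply: weight01 => j; exact: pker01.
    - exact: weight01.
    - have := hw i; case: (sigma i) => [j [Gk cIk]|_]/=; last first.
        by rewrite subrr normr0 mulr0.
      rewrite mulr1; apply: nup => //.
      by apply: fine_ge0; case: (ptsGL (kappa i)).
  have finL : Q (labelled kappa) \is a fin_num by rewrite fin_num_measure.
  have finC : Q (config cI cJ G L sigma `&` labelled kappa) \is a fin_num.
    by rewrite fin_num_measure//; apply: measurableI => //; exact: measurable_config.
  have le1 : (Q (config cI cJ G L sigma `&` labelled kappa) <=
       (pw + eta * n_pts)%:E * Q (labelled kappa))%E.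
    rewrite labelled_marks -integral_cst//; apply: le_integralW => w /dist.
    by rewrite lee_fin ler_norml => /andP[? ?]; lra.
  have le2 : ((pw - eta * n_pts)%:E * Q (labelled kappa) <=
       Q (config cI cJ G L sigma `&` labelled kappa))%E.
    rewrite labelled_marks -integral_cst//; apply: le_integralW => w /dist.
    by rewrite lee_fin ler_norml => /andP[? ?]; lra.
  split => //; move: le2; rewrite -(fineK finL) -(fineK finC).
  by rewrite -!EFinM -EFinD !lee_fin; lra.
apply: (@partition_approx _ _ _ Q _ _ F) => //.
- exact: measurable_config.
- move=> n; rewrite /F; case: pickle_inv => [kappa|]; last exact: measurable0.
  exact: measurable_labelled.
- move=> n n' _ _ [w []]; rewrite /F.
  have := @pickle_invK {ffun I -> nat} n; have := @pickle_invK {ffun I -> nat} n'.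
  case: pickle_inv => [kappa' /= <-|//]; case: pickle_inv => [kappa /= <-|//] lw lw'.
  by rewrite (labelled_inj lw lw').
- by apply: subset_trans coverF; exact: config_sub.
- by apply: prodr_ge0 => i _; case/andP: (weight01 (p i) (sigma i) (p01 i)).
- by rewrite mulr_ge0.
- move=> n; rewrite /F; case: pickle_inv => [kappa|]; last first.
    by rewrite !setI0 measure0 mule0.
  rewrite [X in (_ * Q X)%E](_ : _ = labelled kappa); first by have [] := key kappa.
  by apply/setIidPr => w [].
- move=> n; rewrite /F; case: pickle_inv => [kappa|]; last first.
    by rewrite !setI0 measure0 !mule0 adde0.
  rewrite [X in (_ * Q X)%E](_ : _ = labelled kappa); last first.
    by apply/setIidPr => w [].
  rewrite [X in (_ + _ * Q X)%E](_ : _ = labelled kappa); last first.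
    by apply/setIidPr => w [].
  by have [] := key kappa.
Qed.
End conditional_configurations.

(** * The accumulated input as a sum over the jobs *)

(** The time that a job arriving at g with service time l has spent in service
    before time t. *)
Definition served (R : realType) (t g l : R) : R :=
  Num.min (Num.max (t - g) 0) l.

Lemma served_ge0 (R : realType) (t g l : R) : 0 <= l -> 0 <= served t g l.
Proof. by move=> l0; rewrite /served le_min l0 le_max lexx orbT. Qed.

Lemma served_early (R : realType) (t g l : R) : 0 <= l -> t <= g -> served t g l = 0.
Proof.
move=> l0 tg; rewrite /served (max_idPr _) ?subr_le0//.
by apply/min_idPl.
Qed.

Lemma served_lip (R : realType) (t g g' l l' : R) :
  `|served t g l - served t g' l'| <= `|g - g'| + `|l - l'|.
Proof.
have lip (a b a' b' : R) : `|Num.min a b - Num.min a' b'| <= `|a - a'| + `|b - b'|.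
  rewrite /Num.min; case: ltP => ?; case: ltP => ?; rewrite ?lerDl ?lerDr//;
  rewrite !ler_norml; have := ler_norm (a - a'); have := ler_norm (a' - a);
  have := ler_norm (b - b'); have := ler_norm (b' - b);
  rewrite (distrC a' a) (distrC b' b); lra.
apply: le_trans (lip _ _ _ _) _; rewrite lerD2r.
rewrite /Num.max; case: ltP => ?; case: ltP => ?; rewrite ?subrr ?normr0//;
  rewrite !ler_norml; have := ler_norm (g - g'); have := ler_norm (g' - g);
  rewrite (distrC g' g); lra.
Qed.

Lemma continuous_served (R : realType) (g l : R) :
  continuous (fun t : R => served t g l).
Proof.
move=> t; apply: (@continuous_min _ _ (fun t => Num.max (t - g) 0) (cst l));
  last exact: cvg_cst.
apply: (@continuous_max _ _ (fun t => t - g) (cst 0)); last exact: cvg_cst.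
by apply: cvgB; [exact: cvg_id|exact: cvg_cst].
Qed.

(** A job that arrives at time +oo is absent and contributes nothing. *)
Definition served_ext (R : realType) (t : R) (g : \bar R) (l : R) : \bar R :=
  if (g < +oo)%E then (served t (fine g) l)%:E else 0%E.

Lemma integral_in_service (R : realType) (t : R) (g : \bar R) (l : R) :
  0 <= t -> (0 <= g)%E -> 0 <= l ->
  (\int[lebesgue_measure]_(s in `[0%R, t])
    (\1_[set s | (g < s%:E < g + l%:E)%E] s)%:E = served_ext t g l)%E.
Proof.
move=> t0 g0 l0; case: g g0 => [g| |] // g0; last first.
  rewrite /served_ext ltxx (_ : [set s : R | (+oo < s%:E < +oo + l%:E)%E] = set0); last first.
    by apply/seteqP; split => // s /andP[]; rewrite ltNge leey.
  by apply: integral0_eq => s _; rewrite indicE in_set0.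
rewrite lee_fin in g0; rewrite /served_ext ltry/=.
rewrite (_ : [set s | (g%:E < s%:E < g%:E + l%:E)%E] = `]g, g + l[%classic); last first.
  by apply/seteqP; split => s /=; rewrite in_itv/= -EFinD !lte_fin.
rewrite integral_indic//; have [tgl|glt] := ltP t (g + l).
  rewrite (_ : _ `&` _ = `]g, t]%classic); last first.
    apply/seteqP; split => s /=; rewrite !in_itv/=.
      by move=> [/andP[? ?] /andP[? ?]]; apply/andP.
    by move=> /andP[? ?]; split; apply/andP; split; lra.
  rewrite /= lebesgue_measure_itv/= lte_fin /served; case: ltP => gt.
    by rewrite -EFinB; congr (_%:E); rewrite max_l ?min_l//; lra.
  by rewrite max_r ?min_l//; lra.
rewrite (_ : _ `&` _ = `]g, g + l[%classic); last first.
  apply/seteqP; split => s /=; rewrite !in_itv/=; first by case.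
  by move=> /andP[? ?]; split; apply/andP; split; lra.
rewrite /= lebesgue_measure_itv/= lte_fin /served; case: ltP => gt.
  by rewrite -EFinB; congr (_%:E); rewrite max_l ?min_r//; lra.
have -> : l = 0 by lra.
by rewrite max_l ?min_r//; lra.
Qed.

(** The integral over time is exchanged with the sum over the jobs. *)
Lemma total_inputE (R : realType) (dO : measure_display) (Omega : measurableType dO)
    (G : nat -> Omega -> \bar R) (L : nat -> Omega -> R) t w :
  marked_points G L -> 0 <= t ->
  (total_input G L t w = \sum_(0 <= k <oo) served_ext t (G k w) (L k w))%E.
Proof.
move=> pts t0; rewrite /total_input /active_jobs.
have mterm k : measurable_fun setT (fun s : R =>
    (\1_[set w' | (G k w' < s%:E < G k w' + (L k w')%:E)%E] w)%:E : \bar R).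
  rewrite (_ : (fun _ => _) = fun s : R =>
      (\1_[set s : R | (G k w < s%:E < G k w + (L k w)%:E)%E] s)%:E); last first.
    by apply/funext => s; rewrite !indicE.
  apply/measurable_EFinP; apply: measurable_indic.
  rewrite (_ : mkset _ = [set s : R | (G k w < s%:E)%E] `&`
     [set s : R | (s%:E < G k w + (L k w)%:E)%E]); last first.
    by apply/seteqP; split => s /= => [/andP[]|[-> ->]].
  apply: measurableI.
    rewrite -[X in measurable X]setTI.
    exact: (emeasurable_fun_o_infty measurableT (@EFin_measurable R _)).
  rewrite -[X in measurable X]setTI.
  exact: (emeasurable_fun_infty_o measurableT (@EFin_measurable R _)).
rewrite integral_nneseries//; last first.
  by move=> k; exact: measurable_funTS (mterm k).
apply: eq_eseriesr => k _; case: (pts k) => _ _ G0 L0.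
by rewrite -integral_in_service.
Qed.

Lemma measurable_total_input (R : realType) (dO : measure_display)
    (Omega : measurableType dO) (G : nat -> Omega -> \bar R)
    (L : nat -> Omega -> R) t :
  marked_points G L -> 0 <= t -> measurable_fun setT (total_input G L t).
Proof.
move=> pts t0; rewrite (_ : total_input G L t = fun w =>
    (\sum_(0 <= k <oo) served_ext t (G k w) (L k w))%E); last first.
  by apply/funext => w; exact: total_inputE.
apply: ge0_emeasurable_sum => [k w _ _|k _].
  case: (pts k) => _ _ _ L0; rewrite /served_ext; case: ifP => // _.
  by rewrite lee_fin served_ge0.
case: (pts k) => mG mL _ _; rewrite /served_ext.
apply: measurable_fun_ifT => //; first exact: measurable_fun_lte.
apply/measurable_EFinP; apply: measurable_minr => //.
apply: measurable_maxr => //; apply: measurable_funB => //.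
exact: (measurableT_comp (fine_measurable measurableT)).
Qed.

Section finitely_many_arrivals.
Context (R : realType) (dO : measure_display) (Omega : measurableType dO).
Context (G : nat -> Omega -> \bar R) (L : nat -> Omega -> R) (T : R).
Hypothesis ptsGL : marked_points G L.

Definition arrived (w : Omega) : set nat := [set k | (G k w <= T%:E)%E].

Definition finite_input (w : Omega) (t : R) : R :=
  \sum_(k <- fset_set (arrived w)) served t (fine (G k w)) (L k w).

Lemma total_input_finite w t : finite_set (arrived w) -> 0 <= t <= T ->
  total_input G L t w = (finite_input w t)%:E.
Proof.
move=> fA /andP[t0 tT]; rewrite total_inputE//.
have ext0 k : (0 <= served_ext t (G k w) (L k w))%E.
  case: (ptsGL k) => _ _ _ L0; rewrite /served_ext; case: ifP => // _.
  by rewrite lee_fin served_ge0.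
rewrite nneseries_esumT//.
transitivity (\esum_(k in arrived w) served_ext t (G k w) (L k w))%E.
  rewrite [RHS]esum_mkcond; apply: eq_esum => k _; case: ifPn => // /negP kA.
  have TG : (T%:E < G k w)%E by rewrite ltNge; apply/negP => kT; apply/kA/mem_set.
  case: (ptsGL k) => _ _ G0 L0; rewrite /served_ext; case: ifPn => // Gk.
  rewrite served_early// (le_trans tT)// -lee_fin fineK ?ltW//.
  by rewrite ge0_fin_numE.
rewrite esum_fset// fsbig_finite//= /finite_input -sumEFin.
rewrite big_seq [RHS]big_seq; apply: eq_bigr => k; rewrite in_fset_set// => /set_mem kT.
by rewrite /served_ext (le_lt_trans kT) ?ltry.
Qed.

Lemma path_of_finite_input w t : finite_set (arrived w) -> 0 <= t <= T ->
  path_of (total_input G L) w t = finite_input w t.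
Proof. by move=> fA tT; rewrite /path_of total_input_finite. Qed.

Lemma continuous_sum_served (S : Type) (r : seq S) (g l : S -> R) :
  continuous (fun t : R => \sum_(k <- r) served t (g k) (l k)).
Proof.
elim: r => [|k r IH].
  under [X in continuous X]eq_fun do rewrite big_nil.
  exact: cst_continuous.
under [X in continuous X]eq_fun do rewrite big_cons.
by move=> t; apply: cvgD; [exact: continuous_served|exact: IH].
Qed.

Lemma finite_arrivals_CT w : finite_set (arrived w) ->
  CT T (path_of (total_input G L) w).
Proof.
move=> fA; rewrite /CT /=.
apply: (@subspace_eq_continuous _ _ _ (finite_input w)).
  by move=> t /set_mem; rewrite /= in_itv/= => tT; exact/esym/path_of_finite_input.
by apply: continuous_subspaceT; exact: continuous_sum_served.
Qed.

Context (I J : finType) (cI : I -> set R) (cJ : J -> set R).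
Hypotheses (tcI : trivIset setT cI) (tcJ : trivIset setT cJ)
  (covI : forall s, 0 <= s -> s <= T <-> exists i, cI i s)
  (covJ : forall l, exists j, cJ j l).
Context (a : I -> R) (r : J -> R) (delta : R).
Hypotheses
  (ha : forall i s, cI i s -> `|s - a i| <= delta)
  (hr : forall j l x, cJ j l -> 0 <= l -> x <= T ->
    `|Num.min x l - Num.min x (r j)| <= delta).

Definition config_path (sigma : {ffun I -> option J}) (t : R) : R :=
  \sum_i (if sigma i is Some j then served t (a i) (r j) else 0).

Definition config_size (sigma : {ffun I -> option J}) : nat :=
  \sum_i isSome (sigma i).

(** Every point is moved to the reference point of its cell.  The hypothesis on
    the mark cells compares marks after truncation at a level x <= T, which is all
    that [served] sees of them; this is what allows an unbounded mark cell. *)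
Lemma config_arrivals sigma w : config cI cJ G L sigma w ->
  [/\ finite_set (arrived w), #|` fset_set (arrived w)| = config_size sigma &
   forall t, 0 <= t <= T ->
    `|finite_input w t - config_path sigma t| <= delta *+ 2 *+ config_size sigma].
Proof.
move=> cw; have /(configP _ tcJ covJ)[tw mw] := cw.
have [kappa [_ hw]] := time_config_labelled tw.
pose ks := [seq kappa i | i <- index_enum I & isSome (sigma i)].
have G0 k : (0 <= G k w)%E by case: (ptsGL k).
have kinj : {in [pred i | isSome (sigma i)] &, injective kappa}.
  move=> i i'; rewrite !inE => si si' kk'.
  have := hw i; have := hw i'; case: (sigma i) si => // j _; case: (sigma i') si' => // j' _.
  rewrite kk' => -[_ h'] [_ h]; apply: (@tcI i i') => //.
  by exists (fine (G (kappa i') w)).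
have uks : uniq ks.
  rewrite map_inj_in_uniq ?filter_uniq ?index_enum_uniq// => i i'.
  by rewrite !mem_filter => /andP[? _] /andP[? _]; apply: kinj; rewrite inE.
have ksE : arrived w = [set` ks].
  apply/seteqP; split => k /=.
    rewrite /arrived/= => GkT.
    have Gfin : G k w \is a fin_num.
      by rewrite ge0_fin_numE// (le_lt_trans GkT)// ltry.
    have : fine (G k w) <= T by rewrite -lee_fin fineK.
    move=> /(covI (fine_ge0 (G0 k))).1[i ci].
    have hk : hits cI G k i w by split => //; rewrite -ge0_fin_numE.
    have /time_configP/(_ i) := tw; have := hw i.
    case si : (sigma i) => [j|]; last by move=> _ /(_ k).
    move=> hki [k0 k0E].
    have /= kk0 : [set k0] k by rewrite -k0E.
    have /= ki : [set k0] (kappa i) by rewrite -k0E.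
    by rewrite kk0 -ki; apply/mapP; exists i; rewrite // mem_filter si mem_index_enum.
  move=> /mapP[i]; rewrite mem_filter => /andP[si _] ->.
  have := hw i; case: (sigma i) si => // j _ [Gk ci].
  rewrite /arrived/= -[G _ w]fineK ?ge0_fin_numE// lee_fin.
  by apply/covI; [exact: fine_ge0|exists i].
have fA : finite_set (arrived w) by rewrite ksE; exact: finite_seq.
have pks : perm_eq (fset_set (arrived w)) ks.
  apply: uniq_perm => // k; rewrite in_fset_set//.
  by rewrite ksE; apply/idP/idP => [/set_mem//|?]; exact/mem_set.
split => //.
  by rewrite (perm_size pks) size_map size_filter -sum1_count big_mkcond.
move=> t /andP[t0 tT]; rewrite /finite_input (perm_big _ pks)/=.
rewrite /ks big_map big_filter big_mkcond /config_path -sumrB.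
rewrite (le_trans (ler_norm_sum _ _ _))//.
rewrite /config_size -sumrMnr; apply: ler_sum => i _.
have := hw i; have := mw i; case si : (sigma i) => [j|]/=; last first.
  by rewrite subrr normr0 mulr0n.
move=> /(_ j (kappa i) erefl) mi hi.
have {}mi := mi hi; have [Gk ci] := hi.
rewrite mulr1n; set g := fine _ in ci *; set l := L _ _.
have g0 : 0 <= g := fine_ge0 (G0 _).
have l0 : 0 <= l by have [_ _ _ L0] := ptsGL (kappa i); exact: L0.
rewrite -(subrKA (served t g (r j))) mulr2n.
rewrite (le_trans (ler_normD _ _))// lerD//.
  by apply: hr => //; rewrite ge_max; apply/andP; split; lra.
apply: le_trans (served_lip _ _ _ _ _) _.
by rewrite subrr normr0 addr0 ha.
Qed.

End finitely_many_arrivals.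

(** * Poisson weights of configurations *)

Lemma big_option (R : Type) (idx : R) (op : Monoid.com_law idx) (J : finType)
    (F : option J -> R) :
  \big[op/idx]_o F o = op (F None) (\big[op/idx]_j F (Some j)).
Proof.
rewrite (bigD1 None)//=; congr (op _ _).
rewrite (reindex_omap Some id)/=; last by case.
by apply: eq_bigl => j; rewrite eqxx.
Qed.

(** Independent Poisson counts of the mark cells add up to one Poisson count. *)
Lemma prod_poisson01 (R : realType) (J : finType) (mu : J -> R) (o : option J) :
  \prod_j poisson01 (mu j) (o == Some j) =
  expR (- \sum_j mu j) * mark_weight mu o.
Proof.
rewrite /poisson01 big_split/= -expR_sum sumrN; congr (_ * _).
case: o => [j|] /=; last by rewrite big1// => j _; rewrite expr0.
rewrite (bigD1 j)//= eqxx expr1 big1 ?mulr1// => j' jj'.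
by rewrite (inj_eq (@Some_inj _)) eq_sym (negbTE jj') expr0.
Qed.

Lemma poisson01_ge0 (R : realType) (r : R) b : 0 <= r -> 0 <= poisson01 r b.
Proof. by move=> r0; rewrite mulr_ge0 ?expR_ge0 ?exprn_ge0. Qed.

Section weights.
Context (R : realType) (I J : finType).
Context (mui : I -> R) (muij : I -> J -> R) (p : I -> J -> R) (eta : R).
Hypotheses (mui0 : forall i, 0 <= mui i) (muij0 : forall i j, 0 <= muij i j)
  (muE : forall i, \sum_j muij i j = mui i)
  (p01 : forall i j, 0 <= p i j <= 1) (eta0 : 0 <= eta)
  (mup : forall i j, `|muij i j - p i j * mui i| <= eta * mui i).
Implicit Types sigma : {ffun I -> option J}.

Definition time_weight (m : I -> R) sigma := \prod_i poisson01 (m i) (isSome (sigma i)).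

(** The probability of a configuration when the counts of all product cells are
    independent Poisson variables with means muij. *)
Definition cell_weight sigma :=
  \prod_(ij : I * J) poisson01 (muij ij.1 ij.2) (sigma ij.1 == Some ij.2).

Definition label_weight sigma := \prod_i mark_weight (p i) (sigma i).

Lemma cell_weightE sigma : cell_weight sigma =
  \prod_i (expR (- mui i) * mark_weight (muij i) (sigma i)).
Proof.
rewrite /cell_weight -(pair_bigA _ (fun i j => poisson01 (muij i j) (sigma i == Some j)))/=.
by apply: eq_bigr => i _; rewrite prod_poisson01 muE.
Qed.

Lemma mark_weight01 (q : J -> R) o : (forall j, 0 <= q j <= 1) ->
  0 <= mark_weight q o <= 1.
Proof. by case: o => [j|] //= _; rewrite ler01 lexx. Qed.

Lemma time_weight_ge0 (m : I -> R) sigma : (forall i, 0 <= m i) -> 0 <= time_weight m sigma.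
Proof. by move=> m0; apply: prodr_ge0 => i _; exact: poisson01_ge0. Qed.

(** Poisson thinning: independent Poisson counts with means muij amount to a
    Poisson number of points with mean mui, marked independently with
    probabilities muij / mui, and these are within eta of p. *)
Lemma cell_weight_approx sigma :
  `|cell_weight sigma - label_weight sigma * time_weight mui sigma| <=
  eta * (\sum_i (isSome (sigma i))%:R) * time_weight mui sigma.
Proof.
have muij_le i j : muij i j <= mui i.
  by rewrite -muE (bigD1 j)//= lerDl sumr_ge0.
(* if mui i = 0, no point can occur and any mark probability is admissible *)
pose q i j := if mui i == 0 then p i j else muij i j / mui i.
have qE i j : q i j * mui i = muij i j.
  rewrite /q; case: eqVneq => [m0|m0]; last by rewrite divfK.
  rewrite m0 mulr0; apply/esym/eqP; rewrite eq_le muij0 andbT.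
  by rewrite -m0 muij_le.
have q01 i j : 0 <= q i j <= 1.
  rewrite /q; case: eqVneq => [//|m0].
  have mp : 0 < mui i by rewrite lt_def m0 mui0.
  by rewrite divr_ge0//= ler_pdivrMr// mul1r.
have qp i j : `|q i j - p i j| <= eta.
  rewrite /q; case: eqVneq => [_|m0]; first by rewrite subrr normr0.
  have mp : 0 < mui i by rewrite lt_def m0 mui0.
  rewrite -(ler_pM2r mp) (_ : _ * mui i = `|muij i j - p i j * mui i|)//.
  by rewrite -{2}(gtr0_norm mp) -normrM mulrBl divfK.
have -> : cell_weight sigma = (\prod_i mark_weight (q i) (sigma i)) * time_weight mui sigma.
  rewrite cell_weightE -big_split/=; apply: eq_bigr => i _.
  rewrite /poisson01; case: (sigma i) => [j|] /=; last by rewrite expr0; ring.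
  by rewrite expr1 -qE; ring.
rewrite -mulrBl normrM [X in _ * X <= _]ger0_norm ?time_weight_ge0//.
rewrite ler_wpM2r ?time_weight_ge0// mulr_sumr; apply: dist_prod_le => i.
- by apply: mark_weight01.
- by apply: mark_weight01.
- by case: (sigma i) => [j|] /=; rewrite ?mulr1// subrr normr0 mulr0.
Qed.

(** The number of occupied cells is at most 2 to that power, which turns the sum
    into a product over the cells; each cell contributes a factor at most
    1 + 2 #|J| mui i.  The bound depends on the time cells only through the total
    mean, hence stays bounded when they are refined. *)
Lemma sum_time_weight :
  \sum_(sigma : {ffun I -> option J}) (\sum_i (isSome (sigma i))%:R) * time_weight mui sigma <=
  expR ((2 * #|J|)%:R * \sum_i mui i).
Proof.
pose F i (o : option J) := 2 ^+ isSome o * poisson01 (mui i) (isSome o).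
apply: (@le_trans _ _ (\sum_(sigma : {ffun I -> option J}) \prod_i F i (sigma i))).
  apply: ler_sum => sigma _; rewrite [leRHS]big_split/= ler_wpM2r ?time_weight_ge0//.
  rewrite -natr_sum prodrXr -natrX ler_nat.
  exact/ltnW/ltn_expl.
rewrite -bigA_distr_bigA/= mulr_sumr expR_sum; apply: ler_prod => i _.
rewrite big_option /F/= sumr_const /poisson01 expr0 expr1 expr0 expr1.
have -> : #|xpredT : pred J| = #|J| by apply: eq_card.
rewrite natrM; have e1 : expR (- mui i) <= 1.
  by rewrite -expR0 ler_expR oppr_le0.
have e0 : 0 <= expR (- mui i) by exact: expR_ge0.
have m0 := mui0 i; have n0 : 0 <= #|J|%:R :> R by exact: ler0n.
rewrite -[_ *+ #|J|]mulr_natr; set n := #|J|%:R in n0 *; set e := expR (- _) in e0 e1 *.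
rewrite (_ : _ + _ = e * (1 + 2 * n * mui i)); last by ring.
have p0 : 0 <= 1 + 2 * n * mui i by rewrite addr_ge0// !mulr_ge0.
rewrite mulr_ge0//=; apply: le_trans (expR_ge1Dx _).
by rewrite ler_piMl.
Qed.

(** Two or more points fall into the same time cell with probability at most the
    sum of the squared means. *)
Lemma sum_cell_weight :
  1 - \sum_i (mui i) ^+ 2 <=
  \sum_(sigma : {ffun I -> option J}) cell_weight sigma.
Proof.
rewrite (eq_bigr _ (fun sigma _ => cell_weightE sigma)).
rewrite -(bigA_distr_bigA (fun i o => expR (- mui i) * mark_weight (muij i) o))/=.
have fE i : \sum_o expR (- mui i) * mark_weight (muij i) o = expR (- mui i) * (1 + mui i).
  by rewrite big_option /= -mulr_sumr muE; ring.
rewrite (eq_bigr _ (fun i _ => fE i)).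
have f01 i : 0 <= expR (- mui i) * (1 + mui i) <= 1.
  rewrite mulr_ge0 ?expR_ge0 ?addr_ge0//=.
  by rewrite expRN mulrC ler_pdivrMr ?expR_gt0// mul1r expR_ge1Dx.
have lef i : `|1 - expR (- mui i) * (1 + mui i)| <= mui i ^+ 2.
  rewrite ger0_norm ?subr_ge0; last by case/andP: (f01 i).
  have : (1 - mui i) * (1 + mui i) <= expR (- mui i) * (1 + mui i).
    by rewrite ler_wpM2r ?addr_ge0// expR_ge1Dx.
  rewrite expr2; lra.
have h : `|\prod_(i : I) 1 - \prod_i (expR (- mui i) * (1 + mui i))| <= \sum_i mui i ^+ 2.
  by apply: dist_prod_le => // i; rewrite ler01 lexx.
by move: h; rewrite big1// ler_norml => /andP[_]; lra.
Qed.

End weights.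

(** * Averaging of a rapidly oscillating intensity *)

Section scaling.
Context (R : realType).
Local Notation leb := (@lebesgue_measure R).

Lemma measurable_divr (eps : R) :
  measurable_fun setT (fun s : measurableTypeR R => (s / eps : measurableTypeR R)).
Proof. exact: measurable_funM. Qed.

(** Lebesgue measure is determined by its values on half-open intervals. *)
Lemma lebesgue_measure_divr (eps : R) (A : set (measurableTypeR R)) :
  0 < eps -> measurable A ->
  pushforward leb (fun s : measurableTypeR R => (s / eps : measurableTypeR R)) A =
  (eps%:E * leb A)%E.
Proof.
move=> e0 mA.
pose phi : {mfun measurableTypeR R >-> measurableTypeR R} :=
  HB.pack (fun s : measurableTypeR R => (s / eps : measurableTypeR R))
    (isMeasurableFun.Build _ _ _ _ _ (measurable_divr eps)).
have ei0 : 0 <= eps^-1 by rewrite invr_ge0 ltW.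
rewrite (@lebesgue_measure_unique R (mscale (NngNum ei0) (pushforward leb phi)))//.
  rewrite /mscale/= muleA -EFinM divff ?mul1e//; exact: lt0r_neq0.
move=> _ [[a b] _ <-].
transitivity ((eps^-1)%:E * leb ((fun s : R => (s / eps)%R) @^-1` `]a, b]))%E; last by [].
rewrite (_ : _ @^-1` _ = `]a * eps, b * eps]%classic); last first.
  by apply/seteqP; split => s /=; rewrite !in_itv/= ltr_pdivlMr// ler_pdivrMr.
rewrite !lebesgue_measure_itv/= !lte_fin ltr_pM2r//; case: ifPn => _.
  by rewrite -!EFinB -EFinM -mulrBl mulrC mulfK// lt0r_neq0.
by rewrite mule0.
Qed.

Lemma integral_divr (eps a b : R) (z : R -> R) : 0 < eps ->
  measurable_fun (`]a / eps, b / eps]%classic : set R) z ->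
  (forall u, u \in `]a / eps, b / eps] -> 0 <= z u) ->
  (\int[leb]_(s in `]a, b]) (z (s / eps)%R)%:E =
   eps%:E * \int[leb]_(u in `](a / eps)%R, (b / eps)%R]) (z u)%:E)%E.
Proof.
move=> e0 mz z0.
rewrite (_ : `]a, b]%classic = (fun s : measurableTypeR R => (s / eps : measurableTypeR R))
    @^-1` `]a / eps, b / eps]%classic); last first.
  apply/seteqP; split => s /=; rewrite !in_itv/= ltr_pM2r ?invr_gt0//.
    by rewrite ler_pM2r ?invr_gt0.
  by rewrite ler_pM2r ?invr_gt0.
pose phi : {mfun measurableTypeR R >-> measurableTypeR R} :=
  HB.pack (fun s : measurableTypeR R => (s / eps : measurableTypeR R))
    (isMeasurableFun.Build _ _ _ _ _ (measurable_divr eps)).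
transitivity (\int[pushforward leb phi]_(u in `](a / eps)%R, (b / eps)%R]) (z u)%:E)%E.
  rewrite ge0_integral_pushforward//; first exact/measurable_EFinP.
  by move=> u /set_mem uab; rewrite lee_fin z0.
pose en := NngNum (ltW e0).
rewrite (eq_measure_integral (mscale en leb)); last first.
  by move=> A mA _; exact: (lebesgue_measure_divr e0 mA).
rewrite ge0_integral_mscale//; exact/measurable_EFinP.
Qed.

End scaling.

(** The conclusion, for d near 0, is a property that holds near every point of the
    segment; compactness makes it uniform. *)
Lemma segment_unif_continuous (R : realType) (f : R -> R) (a b : R) :
  {within `[a, b], continuous f} -> forall e, 0 < e ->
  exists2 d, 0 < d & forall s t, s \in `[a, b] -> t \in `[a, b] ->
    `|s - t| < d -> `|f s - f t| <= e.
Proof.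
move=> /subspace_continuousP cf e e0.
have /compact_near_coveringP := segment_compact (a:=a) (b:=b).
move=> /(_ R (0^'+ : set_system R) (fun d s => forall t, s \in `[a, b] -> t \in `[a, b] ->
    `|s - t| < d -> `|f s - f t| <= e) _) [].
  move=> x xab; have /cvgrPdist_lt/(_ (e / 2)) := cf x xab.
  rewrite divr_gt0// => /(_ isT); rewrite near_withinE => -[r /= r0 hr].
  exists (ball x (r / 2), [set d | 0 < d < r / 2]); first split => /=.
  - by exists (r / 2) => //=; rewrite divr_gt0.
  - exists (r / 2) => /=; first by rewrite divr_gt0.
    move=> d /=; rewrite sub0r normrN => dr d0.
    by rewrite d0/= (le_lt_trans (ler_norm _)).
  move=> [s d] /= [xs /andP[d0 dr]] t sab tab st.
  have near_x u : u \in `[a, b] -> `|x - u| < r -> `|f x - f u| < e / 2.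
    by move=> uab xu; exact: hr.
  have xsr : `|x - s| < r by rewrite (lt_trans xs)//; lra.
  have xtr : `|x - t| < r.
    by rewrite -(subrKA s) (le_lt_trans (ler_normD _ _))//; move: xs; rewrite /ball/=; lra.
  rewrite -(subrKA (f x)) (le_trans (ler_normD _ _))//.
  have := near_x s sab xsr; have := near_x t tab xtr.
  by rewrite (distrC (f s)); lra.
move=> d /= d0 h; exists (d / 2); first by rewrite divr_gt0.
move=> s t sab tab st; apply: (h (d / 2)) st => //=; last by rewrite divr_gt0.
by rewrite sub0r normrN gtr0_norm; lra.
Qed.

Section averaging.
Context (R : realType).
Local Notation leb := (@lebesgue_measure R).
Context (z lambda : R -> R) (K zbar : R).
Hypotheses (K0 : 0 < K) (mz : measurable_fun (`[0, +oo[%classic : set R) z)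
  (zK : forall u, 0 <= u -> 0 <= z u <= K) (zbarK : 0 <= zbar <= K)
  (clambda : {within `[0, +oo[, continuous lambda})
  (lambdaK : forall s, 0 <= s -> 0 <= lambda s <= K).
Hypothesis z_avg :
  (t^-1 * \int[leb]_(u in `[0, t]) z u) @[t --> +oo] --> zbar.

(** With t = b / eps this is b times the ergodic average up to time t. *)
Lemma fast_avg (b : R) : 0 <= b ->
  (eps * \int[leb]_(u in `[0, b / eps]) z u) @[eps --> 0^'+] --> b * zbar.
Proof.
rewrite le_eqVlt => /predU1P[<-|b0].
  rewrite mul0r; under eq_fun do rewrite mul0r set_itv1 Rintegral_set1 mulr0.
  exact: cvg_cst.
have h : (b * ((b / eps)^-1 * \int[leb]_(u in `[0, b / eps]) z u)) @[eps --> 0^'+] --> b * zbar.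
  apply: cvgMr.
  apply: (cvg_comp (fun eps => b / eps)
    (fun t => t^-1 * \int[leb]_(u in `[0, t]) z u)) z_avg.
  apply/cvgryPge => A; near=> eps.
  have eps0 : 0 < eps by near: eps; exact: nbhs_right_gt.
  rewrite ler_pdivlMr// (@le_trans _ _ ((`|A| + 1) * eps))//.
    by rewrite ler_pM2r// (le_trans (ler_norm A))// lerDl.
  rewrite mulrC -ler_pdivlMr ?ltr_wpDl//.
  by near: eps; apply: nbhs_right_le; rewrite divr_gt0// ltr_wpDl.
apply: cvg_trans h; apply: near_eq_cvg; near=> eps.
have eps0 : 0 < eps by near: eps; exact: nbhs_right_gt.
by rewrite invf_div mulrA; congr (_ * _); rewrite mulrCA divff ?mulr1// gt_eqF.
Unshelve. all: by end_near.
Qed.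

Lemma bounded_itv_integrable (f : R -> R) (M : R) (i : interval R) :
  (leb [set` i] < +oo)%E -> measurable_fun [set` i] f ->
  (forall u, u \in i -> `|f u| <= M) -> leb.-integrable [set` i] (EFin \o f).
Proof.
move=> li mf fM; apply: measurable_bounded_integrable => //.
exists M; split; first exact: num_real.
by move=> x Mx u ui; apply: (le_trans (fM u ui)); exact: ltW.
Qed.

Lemma fast_increment (eps a b : R) : 0 < eps -> 0 <= a -> a <= b ->
  \int[leb]_(s in `]a, b]) z (s / eps) =
  eps * \int[leb]_(u in `[0, b / eps]) z u - eps * \int[leb]_(u in `[0, a / eps]) z u.
Proof.
move=> e0 a0 ab; have ae : 0 <= a / eps by rewrite divr_ge0// ltW.
have abe : a / eps <= b / eps by rewrite ler_pM2r ?invr_gt0.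
rewrite -mulrBr Rintegral_itvB//; last 1 first.
- apply: (@bounded_itv_integrable _ K) => /=.
  + by rewrite lebesgue_measure_itv/=; case: ifP => // _; rewrite -EFinB ltry.
  + apply: measurable_funS mz => //; by apply/subset_itvP => //=; apply: subset_itvl.
  + by move=> u; rewrite in_itv/= => /andP[u0 _]; rewrite ger0_norm; case/andP: (zK u0).
have sub0 : `](a / eps), (b / eps)]%classic `<=` `[0, +oo[%classic.
  by move=> u /=; rewrite !in_itv/= andbT => /andP[? _]; lra.
rewrite /Rintegral integral_divr//.
- rewrite fineM// integrable_fin_num//.
  apply: (@bounded_itv_integrable _ K) => /=.
  + by rewrite lebesgue_measure_itv/=; case: ifP => // _; rewrite -EFinB ltry.
  + exact: measurable_funS mz.
  + move=> u /sub0; rewrite /= in_itv/= andbT => u0.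
    by have /andP[? ?] := zK u0; rewrite ger0_norm.
- exact: measurable_funS mz.
- by move=> u /sub0; rewrite /= in_itv/= andbT => u0; case/andP: (zK u0).
Qed.

Lemma measurable_rescaled eps u v : 0 < eps -> 0 <= u ->
  measurable_fun (`]u, v]%classic : set R) (fun s => z (s / eps)).
Proof.
move=> e0 u0.
have mD : measurable (`[0, +oo[%classic : set R) by [].
have mg : measurable_fun (`]u, v]%classic : set R) (fun s : R => s / eps).
  exact: measurable_funTS (measurable_divr eps).
refine (measurable_comp mD _ mz mg).
move=> _ [s /= + <-]; rewrite !in_itv/= !andbT => /andP[us _].
by rewrite divr_ge0// ltW// (le_lt_trans u0).
Qed.
(** The fluctuation of the fast intensity around the averaged one. *)
Let wave eps s := lambda s * (z (s / eps) - zbar).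

Lemma measurable_wave eps u v : 0 < eps -> 0 <= u ->
  measurable_fun (`]u, v]%classic : set R) (wave eps).
Proof.
move=> e0 u0.
have sub0 : `]u, v]%classic `<=` `[0, +oo[%classic.
  by move=> s /=; rewrite !in_itv/= andbT => /andP[? _]; lra.
apply: measurable_funM.
  apply: measurable_funS sub0 _ => //.
  exact: subspace_continuous_measurable_fun.
apply: measurable_funB => //.
exact: measurable_rescaled.
Qed.

Lemma wave_le eps s : 0 < eps -> 0 <= s -> `|z (s / eps) - zbar| <= K.
Proof.
move=> e0 s0; have /andP[? ?] := zK (divr_ge0 s0 (ltW e0)); move: zbarK => /andP[? ?].
by rewrite ler_norml; lra.
Qed.

Lemma wave_integrable eps u v : 0 < eps -> 0 <= u ->
  leb.-integrable `]u, v] (EFin \o wave eps).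
Proof.
move=> e0 u0; apply: (@bounded_itv_integrable _ (K * K)).
- by rewrite lebesgue_measure_itv/=; case: ifP => // _; rewrite -EFinB ltry.
- exact: measurable_wave.
- move=> s; rewrite in_itv/= => /andP[us _]; have s0 : 0 <= s by lra.
  rewrite normrM ler_pM//; last exact: wave_le.
  by have /andP[? ?] := lambdaK s0; rewrite ger0_norm.
Qed.

(** On a short interval lambda is replaced by its value at the right end, and then
    only the increment of the ergodic integral remains. *)
Lemma wave_step eta u v zeta : 0 <= u -> u <= v -> 0 <= eta ->
  (forall s, s \in `]u, v] -> `|lambda s - lambda v| <= eta) -> 0 < zeta ->
  \forall eps \near 0^'+,
    `|\int[leb]_(s in `]u, v]) wave eps s| <= eta * K * (v - u) + zeta.
Proof.
move=> u0 uv eta0 lv zeta0.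
have v0 : 0 <= v by lra.
have lvK : `|lambda v| <= K.
  by have /andP[? ?] := lambdaK v0; rewrite ger0_norm.
have : (eps * \int[leb]_(w in `[0, v / eps]) z w -
   eps * \int[leb]_(w in `[0, u / eps]) z w) @[eps --> 0^'+] --> v * zbar - u * zbar.
  by apply: cvgB; exact: fast_avg.
move=> /cvgrPdist_le/(_ (zeta / K)); rewrite divr_gt0// => /(_ isT) near_incr.
near=> eps.
have e0 : 0 < eps by near: eps; exact: nbhs_right_gt.
have sub0 : `]u, v]%classic `<=` `[0, +oo[%classic.
  by move=> s /=; rewrite !in_itv/= andbT => /andP[? _]; lra.
have lfin : (leb `]u, v]%classic < +oo)%E.
  by rewrite lebesgue_measure_itv/=; case: ifP => // _; rewrite -EFinB ltry.
have mz' : measurable_fun (`]u, v]%classic : set R) (fun s => z (s / eps)).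
  exact: measurable_rescaled.
have iz : leb.-integrable `]u, v] (EFin \o (fun s => z (s / eps))).
  apply: (@bounded_itv_integrable _ K) => // s; rewrite in_itv/= => /andP[us _].
  have s0 : 0 <= s by lra.
  by have /andP[? ?] := zK (divr_ge0 s0 (ltW e0)); rewrite ger0_norm.
have ic c : leb.-integrable `]u, v] (EFin \o (fun=> c : R)).
  by apply: (@bounded_itv_integrable _ `|c|).
have izb : leb.-integrable `]u, v] (EFin \o (fun s => z (s / eps) - zbar)).
  apply: (@bounded_itv_integrable _ K) => //; first exact: measurable_funB.
  move=> s; rewrite in_itv/= => /andP[us _]; apply: wave_le => //; lra.
have ml : measurable_fun (`]u, v]%classic : set R) lambda.
  apply: measurable_funS sub0 _ => //.
  exact: subspace_continuous_measurable_fun.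
have ir : leb.-integrable `]u, v] (EFin \o (fun s => (lambda s - lambda v) * (z (s / eps) - zbar))).
  apply: (@bounded_itv_integrable _ (eta * K)) => //.
    by apply: measurable_funM; apply: measurable_funB.
  move=> s suv; rewrite normrM ler_pM// ?lv//; apply: wave_le => //.
  by move: suv; rewrite in_itv/= => /andP[us _]; lra.
have -> : \int[leb]_(s in `]u, v]) wave eps s =
   lambda v * (\int[leb]_(s in `]u, v]) z (s / eps) - zbar * (v - u)) +
   \int[leb]_(s in `]u, v]) ((lambda s - lambda v) * (z (s / eps) - zbar)).
  have -> : zbar * (v - u) = \int[leb]_(s in `]u, v]) zbar.
    rewrite Rintegral_cst//= lebesgue_measure_itv/= lte_fin; congr (_ * _).
    by case: ltP => [//|vu]; apply/eqP; rewrite subr_eq0 eq_le vu uv.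
  rewrite -RintegralB// -RintegralZl// -RintegralD//.
    by apply: eq_Rintegral => s _; rewrite /wave; ring.
  apply: (@bounded_itv_integrable _ (K * K)) => //.
    by apply: measurable_funM => //; apply: measurable_funB.
  move=> s suv; rewrite normrM ler_pM//; apply: wave_le => //.
  by move: suv; rewrite in_itv/= => /andP[us _]; lra.
rewrite addrC (le_trans (ler_normD _ _))// lerD//.
  apply: le_trans (le_normr_Rintegral _ _) _ => //.
  rewrite (_ : _ * (v - u) = \int[leb]_(s in `]u, v]) (eta * K)); last first.
    rewrite Rintegral_cst//= lebesgue_measure_itv/= lte_fin; congr (_ * _).
    by case: ltP => [//|vu]; apply/eqP; rewrite subr_eq0 eq_le vu uv.
  apply: le_Rintegral => //; first exact: integrable_norm.
  move=> s suv; rewrite normrM ler_pM// ?lv//; apply: wave_le => //.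
  by move: suv; rewrite /= in_itv/= => /andP[us _]; lra.
rewrite normrM (@le_trans _ _ (K * (zeta / K)))//; last by rewrite mulrC divfK// gt_eqF.
rewrite ler_pM// fast_increment// distrC mulrC mulrBl.
by near: eps.
Unshelve. all: by end_near.
Qed.

(** The errors eta * K * h of the steps add up to a multiple of the length, while
    each of the q vanishing terms gets its share of zeta. *)
Lemma wave_partition eta h a (q : nat) zeta : 0 <= a -> 0 <= h -> 0 <= eta ->
  (forall s t, s \in `[a, a + h *+ q] -> t \in `[a, a + h *+ q] ->
     `|s - t| <= h -> `|lambda s - lambda t| <= eta) -> 0 < zeta ->
  \forall eps \near 0^'+,
    `|\int[leb]_(s in `]a, a + h *+ q]) wave eps s| <= eta * K * (h *+ q) + zeta.
Proof.
move=> a0 h0 eta0; elim: q zeta => [|q IH] zeta lq zeta0.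
  near=> eps; rewrite mulr0n addr0 set_itvoc0 Rintegral_set0 normr0.
  by rewrite mulr0 add0r ltW.
have hq : 0 <= h *+ q by rewrite mulrn_wge0.
have z2 : 0 < zeta / 2 by rewrite divr_gt0.
have near1 := IH _ _ z2; have {}near1 := near1 _.
have near2 : \forall eps \near 0^'+,
    `|\int[leb]_(s in `]a + h *+ q, a + h *+ q.+1]) wave eps s| <=
     eta * K * (a + h *+ q.+1 - (a + h *+ q)) + zeta / 2.
  apply: wave_step => //.
  - by rewrite addr_ge0.
  - by rewrite lerD2l mulrS lerDr.
  - move=> s; rewrite in_itv/= mulrS => /andP[s1 s2]; apply: lq.
    + by rewrite in_itv/= mulrS; apply/andP; split; lra.
    + by rewrite in_itv/= mulrS lexx andbT; lra.
    + by rewrite ler_norml; apply/andP; split; lra.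
near=> eps.
have e0 : 0 < eps by near: eps; exact: nbhs_right_gt.
have -> : \int[leb]_(s in `]a, a + h *+ q.+1]) wave eps s =
   \int[leb]_(s in `]a, a + h *+ q]) wave eps s +
   \int[leb]_(s in `]a + h *+ q, a + h *+ q.+1]) wave eps s.
  rewrite -(@Rintegral_itvB _ _ (BRight a) (BRight (a + h *+ q.+1)) (a + h *+ q)) ?subrKC//.
  - exact: wave_integrable.
  - by rewrite bnd_simp lerDl.
  - by rewrite bnd_simp mulrS lerD2l lerDr.
rewrite (le_trans (ler_normD _ _))//.
have n1 : `|\int[leb]_(s in `]a, a + h *+ q]) wave eps s| <=
   eta * K * (h *+ q) + zeta / 2.
  near: eps; apply: near1 => s t sq tq; apply: lq.
  - by move: sq; rewrite !in_itv/= mulrS => /andP[? ?]; apply/andP; split; lra.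
  - by move: tq; rewrite !in_itv/= mulrS => /andP[? ?]; apply/andP; split; lra.
have n2 : `|\int[leb]_(s in `]a + h *+ q, a + h *+ q.+1]) wave eps s| <=
     eta * K * (a + h *+ q.+1 - (a + h *+ q)) + zeta / 2 by near: eps.
apply: le_trans (lerD n1 n2) _; rewrite (mulrS h q); lra.
Unshelve. all: by end_near.
Qed.

Lemma cvg_wave a b : 0 <= a -> a <= b ->
  (\int[leb]_(s in `]a, b]) wave eps s) @[eps --> 0^'+] --> 0.
Proof.
move=> a0 ab; apply/cvgrPdist_le => e e0.
have bd : 0 < 2 * K * (b - a + 1) by rewrite !mulr_gt0//; lra.
have eta0 : 0 < e / (2 * K * (b - a + 1)) by rewrite divr_gt0.
have clab : {within `[a, b], continuous lambda}.
  apply: continuous_subspaceW clambda => s /=; rewrite !in_itv/= andbT => /andP[? _]; lra.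
have [d d0 lu] := segment_unif_continuous clab eta0.
pose q := (Num.truncn ((b - a) / d)).+1.
have hq : ((b - a) / q%:R) *+ q = b - a.
  by rewrite -mulr_natr divfK// pnatr_eq0.
have hd : (b - a) / q%:R < d.
  rewrite ltr_pdivrMr// mulrC -ltr_pdivrMr//.
  by rewrite truncnS_gt.
have := @wave_partition (e / (2 * K * (b - a + 1))) ((b - a) / q%:R) a q (e / 2) a0 _ (ltW eta0).
rewrite hq subrKC => h; near=> eps.
rewrite sub0r normrN (@le_trans _ _ (e / (2 * K * (b - a + 1)) * K * (b - a) + e / 2))//.
  near: eps; apply: h; rewrite ?divr_ge0 ?subr_ge0 ?divr_gt0//.
  by move=> s t sab tab st; apply: lu => //; rewrite (le_lt_trans st).
rewrite (_ : _ * K * (b - a) = e / 2 * ((b - a) / (b - a + 1))); last first.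
  by field; rewrite ?gt_eqF//; lra.
have : (b - a) / (b - a + 1) <= 1 by rewrite ler_pdivrMr; lra.
have e2 : 0 < e / 2 by rewrite divr_gt0.
by move=> /(ler_wpM2l (ltW e2)); lra.
Unshelve. all: by end_near.
Qed.

Lemma cvg_fast_intensity a b : 0 <= a -> a <= b ->
  (\int[leb]_(s in `]a, b]) (lambda s * z (s / eps))) @[eps --> 0^'+] -->
  \int[leb]_(s in `]a, b]) (zbar * lambda s).
Proof.
move=> a0 ab.
have sub0 : `]a, b]%classic `<=` `[0, +oo[%classic.
  by move=> s /=; rewrite !in_itv/= andbT => /andP[? _]; lra.
have il : leb.-integrable `]a, b] (EFin \o (fun s => zbar * lambda s)).
  apply: (@bounded_itv_integrable _ (K * K)).
  - by rewrite lebesgue_measure_itv/=; case: ifP => // _; rewrite -EFinB ltry.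
  - apply: measurable_funM => //; apply: measurable_funS sub0 _ => //.
    exact: subspace_continuous_measurable_fun.
  - move=> s; rewrite in_itv/= => /andP[us _]; have s0 : 0 <= s by lra.
    have /andP[? ?] := lambdaK s0; move: zbarK => /andP[? ?].
    by rewrite normrM ler_pM// ger0_norm.
have h : (\int[leb]_(s in `]a, b]) wave eps s + \int[leb]_(s in `]a, b]) (zbar * lambda s))
   @[eps --> 0^'+] --> 0 + \int[leb]_(s in `]a, b]) (zbar * lambda s).
  by apply: cvgD; [exact: cvg_wave|exact: cvg_cst].
rewrite add0r in h; apply: cvg_trans h; apply: near_eq_cvg; near=> eps.
have e0 : 0 < eps by near: eps; exact: nbhs_right_gt.
rewrite -RintegralD//; last exact: wave_integrable.
by apply: eq_Rintegral => s _; rewrite /wave; ring.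
Unshelve. all: by end_near.
Qed.

End averaging.

(** * Expectations of functionals on the space of paths *)

(** The uniform topology on [0, T], in terms of distances of paths. *)
Lemma CT_continuity (R : realType) (T : R) (phi : {uniform` `[0, T] -> R} -> R)
    (f : R -> R) :
  {within CT T, continuous phi} -> CT T f -> forall e, 0 < e ->
  exists2 r, 0 < r & forall g : R -> R, CT T g ->
    (forall t, 0 <= t <= T -> `|f t - g t| < r) -> `|phi f - phi g| < e.
Proof.
move=> /subspace_continuousP cphi fC e e0.
have /cvgrPdist_lt/(_ _ e0) := cphi f fC.
rewrite near_withinE => /uniform_nbhs[E [entE EP]].
move: entE; rewrite -entourage_ballE => -[r /= r0 rE]; exists r => // g gC fg.
apply: EP => // t; rewrite /= in_itv/= => tT; apply: rE => /=.
exact: fg.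
Qed.

Section sandwich.
Context (R : realType) (d : measure_display) (Omega : measurableType d)
  (Q : probability Omega R) (S : finType) (E : S -> set Omega).
Hypothesis mE : forall s, measurable (E s).
Hypothesis tE : forall s s' w, E s w -> E s' w -> s = s'.

Lemma integral_step (a : R) (b : S -> R) (r : seq S) :
  (\int[Q]_w (a + \sum_(s <- r) b s * \1_(E s) w)%:E)%E =
  (a + \sum_(s <- r) b s * fine (Q (E s)))%:E.
Proof.
have Qfin : (Q setT < +oo)%E by rewrite probability_setT ltry.
have mstep r' : measurable_fun setT (fun w => a + \sum_(s <- r') b s * \1_(E s) w).
  apply: measurable_funD => //; apply: measurable_sum => s.
  by apply: measurable_funM => //; exact: measurable_indic.
have istep r' : Q.-integrable setT (EFin \o (fun w => a + \sum_(s <- r') b s * \1_(E s) w)).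
  apply: measurable_bounded_integrable; first exact: measurableT.
  - exact: Qfin.
  - exact: mstep.
  exists (`|a| + \sum_(s <- r') `|b s|); split; first exact: num_real.
  move=> x xM w _ /=; apply: le_trans (ltW xM); rewrite (le_trans (ler_normD _ _))// lerD//.
  rewrite (le_trans (ler_norm_sum _ _ _))//; apply: ler_sum => s _.
  by rewrite normrM ler_piMr// indicE; case: (_ \in _); rewrite ?normr1 ?normr0.
have iind s : Q.-integrable setT (EFin \o (fun w => b s * \1_(E s) w)).
  apply: measurable_bounded_integrable; first exact: measurableT.
  - exact: Qfin.
  - by apply: measurable_funM => //; exact: measurable_indic.
  - exists `|b s|; split; first exact: num_real.
    move=> x xM w _ /=; apply: le_trans (ltW xM).
    by rewrite normrM ler_piMr// indicE; case: (_ \in _); rewrite ?normr1 ?normr0.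
elim: r => [|s r IH].
  under eq_integral do rewrite big_nil.
  rewrite big_nil; transitivity ((a + 0)%:E * Q setT)%E.
    by rewrite -integral_cst.
  by rewrite probability_setT mule1.
under eq_integral do rewrite big_cons addrCA EFinD.
rewrite integralD//; [|exact: iind|exact: istep].
rewrite IH big_cons addrCA [RHS]EFinD; congr (_ + _)%E.
rewrite -(@fineK _ (Q (E s))) ?fin_num_measure//.
under eq_integral do rewrite EFinM.
rewrite integralZl//; last first.
  apply: measurable_bounded_integrable; first exact: measurableT.
  - exact: Qfin.
  - exact: measurable_indic.
  - exists 1; split; first exact: num_real.
    move=> x xM w _ /=; apply: le_trans (ltW xM).
    by rewrite indicE; case: (_ \in _); rewrite ?normr1 ?normr0.
by rewrite integral_indic// setIT EFinM fineK// fin_num_measure.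
Qed.

Lemma disjoint_sum_le (B : set Omega) (b : pred S) : measurable B ->
  (forall s, b s -> E s `<=` B) ->
  \sum_(s | b s) fine (Q (E s)) <= fine (Q B).
Proof.
move=> mB EB.
have : (\int[Q]_w (0 + \sum_s (b s)%:R * \1_(E s) w)%:E <= \int[Q]_w (\1_B w)%:E)%E.
  apply: le_integralW => w _; rewrite lee_fin add0r.
  have [[s bs Es]|nE] := pselect (exists2 s, b s & E s w).
    rewrite (bigD1 s)//= bs !indicE !mem_set//; last exact: (EB s).
    rewrite mulr1 big1 ?addr0// => s' ss'; rewrite indicE memNset ?mulr0// => Es'.
    by move: ss'; rewrite (tE Es Es') eqxx.
  rewrite big1// => s _; case: (boolP (b s)) => bs; last by rewrite mul0r.
  by rewrite indicE memNset ?mulr0// => Es; apply: nE; exists s.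
rewrite integral_step integral_indic// setIT add0r => h.
rewrite -lee_fin fineK ?fin_num_measure//; apply: le_trans h.
rewrite lee_fin [leLHS]big_mkcond; apply: ler_sum => s _.
by case: (b s); rewrite ?mul1r ?mul0r.
Qed.

(** The bracketing functions are v s - e s and v s + e s on E s, and - M and M
    outside these events; their integrals are the two sides of the estimate. *)
Lemma integral_sandwich (D : set Omega) (f : Omega -> R) (v e : S -> R) (M : R) :
  0 <= M -> (forall w, D w -> `|f w| <= M) ->
  (forall s w, E s w -> D w /\ `|f w - v s| <= e s) ->
  exists2 x : R, (\int[Q]_(w in D) (f w)%:E)%E = x%:E &
  `|x - \sum_s v s * fine (Q (E s))| <=
    \sum_s e s * fine (Q (E s)) + M * (1 - \sum_s fine (Q (E s))).
Proof.
move=> M0 fM fE.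
set qs := fun s => fine (Q (E s)).
have pick_step (a : R) (b : S -> R) w :
    (exists2 s, E s w & a + \sum_s b s * \1_(E s) w = a + b s) \/
    ((forall s, ~ E s w) /\ a + \sum_s b s * \1_(E s) w = a).
  have [[s Es]|nE] := pselect (exists s, E s w).
    left; exists s => //; rewrite (bigD1 s)//= indicE mem_set// mulr1 big1 ?addr0// => s' ss'.
    rewrite indicE memNset ?mulr0// => Es'.
    by move: ss'; rewrite (tE Es Es') eqxx.
  right; split; first by move=> s Es; apply: nE; exists s.
  rewrite big1 ?addr0// => s _; rewrite indicE memNset ?mulr0// => Es.
  by apply: nE; exists s.
have hi : (\int[Q]_(w in D) (f w)%:E <= (M + \sum_s (v s + e s - M) * qs s)%:E)%E.
  rewrite -integral_step [leLHS]integral_mkcond; apply: le_integralW => w _.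
  rewrite /patch; have [[s Es ->]|[nE ->]] := pick_step M (fun s => v s + e s - M) w.
    have [Dw fv] := fE _ _ Es; rewrite mem_set// lee_fin.
    by move: fv; rewrite ler_norml => /andP[? ?]; lra.
  case: ifPn => [/set_mem /fM|_]; last by rewrite lee_fin.
  by rewrite lee_fin ler_norml => /andP[].
have lo : ((- M + \sum_s (v s - e s + M) * qs s)%:E <= \int[Q]_(w in D) (f w)%:E)%E.
  rewrite -integral_step [leRHS]integral_mkcond; apply: le_integralW => w _.
  rewrite /patch; have [[s Es ->]|[nE ->]] := pick_step (- M) (fun s => v s - e s + M) w.
    have [Dw fv] := fE _ _ Es; rewrite mem_set// lee_fin.
    by move: fv; rewrite ler_norml => /andP[? ?]; lra.
  case: ifPn => [/set_mem /fM|_]; last by rewrite lee_fin oppr_le0.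
  by rewrite lee_fin ler_norml => /andP[].
have fin : (\int[Q]_(w in D) (f w)%:E \is a fin_num)%E.
  by rewrite fin_numElt (lt_le_trans _ lo) ?ltNyr// (le_lt_trans hi) ?ltry.
exists (fine (\int[Q]_(w in D) (f w)%:E)%E); first by rewrite fineK.
move: hi lo; rewrite -{1 2}(fineK fin) !lee_fin.
have -> : \sum_s (v s + e s - M) * qs s =
    \sum_s v s * qs s + \sum_s e s * qs s - M * \sum_s qs s.
  by rewrite mulr_sumr -big_split -sumrB/=; apply: eq_bigr => s _; ring.
have -> : \sum_s (v s - e s + M) * qs s =
    \sum_s v s * qs s - \sum_s e s * qs s + M * \sum_s qs s.
  by rewrite mulr_sumr -sumrB -big_split/=; apply: eq_bigr => s _; ring.
by move=> hi lo; rewrite ler_norml; apply/andP; split; lra.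
Qed.

End sandwich.

Lemma poisson_count_ae (R : realType) (dO dE : measure_display)
    (Omega : measurableType dO) (E : measurableType dE)
    (Q : probability Omega R) (mu : set E -> \bar R)
    (N : set E -> Omega -> \bar R) (B : set E) (A : Omega -> set nat) :
  poisson_random_measure Q mu N -> measurable B -> (mu B < +oo)%E ->
  measurable_fun setT (N B) -> (forall w, N B w = counting (A w)) ->
  {ae Q, forall w, finite_set (A w)}.
Proof.
move=> pN mB muB mN NA.
have := poisson_finite pN mB muB mN.
set W := [set w | _] => W1.
have WE : W = [set w | (N B w < +oo)%E].
  apply/seteqP; split => w /= => [[n ->]|]; first exact: ltry.
  rewrite NA => /counting_lty fA; exists #|` fset_set (A w)|.
  by rewrite NA /counting asboolT.
have mW : measurable W.
  rewrite WE -[X in measurable X]setTI; exact: emeasurable_fun_infty_o.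
exists (~` W); split; first exact: measurableC.
  by rewrite probability_setC// W1 subee.
move=> w /= nf; rewrite WE /= => Nw; apply: nf.
by apply/(@counting_lty R); rewrite -NA.
Qed.

(** * The grid of times and marks *)

Section grid.
Context (R : realType) (T : R) (m n : nat).
Hypothesis T0 : 0 < T.

Definition mesh (k : nat) : R := T / k.+1%:R.

(** The cell 0 contains no positive time.  It isolates the time 0, where the kernel
    need not be close to its values at positive times. *)
Definition time_cell (i : 'I_m.+2) : set R :=
  `]((i : nat)%:R - 1) * mesh m, (i : nat)%:R * mesh m]%classic.

Definition time_point (i : 'I_m.+2) : R := (i : nat)%:R * mesh m.

(** A mark cell is a difference of two consecutive upper sets, so its probability
    is a difference of two tail probabilities, to which the Lipschitz bound on the
    tails applies.  That bound is for positive levels, hence the whole line is taken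
    at level 0; the last cell consists of the marks beyond T. *)
Definition upper_marks (j : nat) : set R :=
  if j == 0%N then setT
  else if (j <= n.+1)%N then `]j%:R * mesh n, +oo[%classic else set0.

Definition mark_cell (j : 'I_n.+2) : set R := upper_marks j `\` upper_marks j.+1.

Definition mark_point (j : 'I_n.+2) : R := (j : nat)%:R * mesh n.

Lemma mesh_gt0 k : 0 < mesh k.
Proof. by rewrite divr_gt0. Qed.

Lemma mesh_mulS k : k.+1%:R * mesh k = T.
Proof. by rewrite mulrC divfK// pnatr_eq0. Qed.

Lemma measurable_upper_marks j : measurable (upper_marks j).
Proof. by rewrite /upper_marks; case: ifP => // _; case: ifP. Qed.

Lemma measurable_mark_cell j : measurable (mark_cell j).
Proof. by apply: measurableD; exact: measurable_upper_marks. Qed.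

Lemma upper_marksS j : upper_marks j.+1 `<=` upper_marks j.
Proof.
move=> l; rewrite /upper_marks/=; case: eqVneq => [->//|j0].
case: ifPn => // jn; rewrite (ltnW jn) /= !in_itv/= !andbT; apply: le_lt_trans.
by rewrite ler_pM2r ?mesh_gt0// ler_nat.
Qed.

Lemma upper_marks_le i j : (i <= j)%N -> upper_marks j `<=` upper_marks i.
Proof.
elim: j => [|j IH]; first by rewrite leqn0 => /eqP ->.
rewrite leq_eqVlt => /predU1P[->//|/IH h]; exact: subset_trans (@upper_marksS j) h.
Qed.

Lemma trivIset_mark_cell : trivIset setT mark_cell.
Proof.
move=> i j _ _ [l [[il ni] [jl nj]]]; apply/val_inj.
case: (ltngtP i j) => // ij.
- by case: ni; exact: (upper_marks_le ij jl).
- by case: nj; exact: (upper_marks_le ij il).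
Qed.

Lemma mark_cell_cover l : exists j, mark_cell j l.
Proof.
have nU : ~ upper_marks n.+2 l by rewrite /upper_marks/= ltnn.
have first k : ~ upper_marks k l ->
    exists2 j, (j < k)%N & upper_marks j l /\ ~ upper_marks j.+1 l.
  elim: k => [|k IH] nk; first by exfalso; apply: nk.
  have [uk|/IH[j jk h]] := pselect (upper_marks k l); first by exists k.
  by exists j => //; exact: ltnW.
by have [j jn h] := first _ nU; exists (Ordinal jn).
Qed.

Lemma measurable_time_cell i : measurable (time_cell i).
Proof. exact: measurable_itv. Qed.

Lemma trivIset_time_cell : trivIset setT time_cell.
Proof.
move=> i j _ _ [s []]; rewrite /time_cell /= !in_itv/= => /andP[i1 i2] /andP[j1 j2].
have d0 := mesh_gt0 m; apply/val_inj => /=.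
case: (ltngtP i j) => // ij.
- have h : (i : nat)%:R * mesh m <= ((j : nat)%:R - 1) * mesh m.
    by rewrite ler_pM2r// lerBrDr natr1 ler_nat.
  by exfalso; lra.
- have h : (j : nat)%:R * mesh m <= ((i : nat)%:R - 1) * mesh m.
    by rewrite ler_pM2r// lerBrDr natr1 ler_nat.
  by exfalso; lra.
Qed.

Lemma time_cell_cover s : 0 <= s -> s <= T <-> exists i, time_cell i s.
Proof.
move=> s0; have d0 := mesh_gt0 m; split=> [sT|[i]]; last first.
  rewrite /time_cell/= in_itv/= => /andP[_ /le_trans]; apply.
  by rewrite -[leRHS](mesh_mulS m) ler_pM2r// ler_nat -ltnS ltn_ord.
have exk : exists k : nat, s <= k%:R * mesh m.
  by exists m.+1; rewrite mesh_mulS.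
case: (ex_minnP exk) => k sk kmin.
have km : (k < m.+2)%N by rewrite ltnS; apply: kmin; rewrite mesh_mulS.
exists (Ordinal km); rewrite /time_cell/= in_itv/= sk andbT.
case: k {km} sk kmin => [|k] sk kmin; first by rewrite sub0r mulN1r; lra.
rewrite -natr1 addrK ltNge; apply/negP => /kmin; by rewrite ltnn.
Qed.

Lemma time_cell_dist i s : time_cell i s -> `|s - time_point i| <= mesh m.
Proof.
rewrite /time_cell /time_point/= in_itv/= => /andP[s1 s2].
by rewrite ler_norml; apply/andP; split; lra.
Qed.

(** In the last cell, both the mark and its reference T are at least x. *)
Lemma mark_cell_dist j l x : mark_cell j l -> 0 <= l -> x <= T ->
  `|Num.min x l - Num.min x (mark_point j)| <= mesh n.
Proof.
move=> [uj nuj] l0 xT; have d0 := mesh_gt0 n.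
have lj : mark_point j <= l.
  move: uj; rewrite /upper_marks /mark_point; case: eqVneq => [->|j0]; first by rewrite mul0r.
  by rewrite -ltnS ltn_ord /= in_itv/= andbT => /ltW.
have [jn|jn] := eqVneq (j : nat) n.+1.
  have r : mark_point j = T by rewrite /mark_point jn mesh_mulS.
  have lT : T <= l by rewrite -r.
  by rewrite r !min_l ?subrr ?normr0 ?(ltW d0)// (le_trans xT).
have jn' : (j < n.+1)%N by rewrite ltn_neqAle jn -ltnS ltn_ord.
have lj1 : l <= mark_point j + mesh n.
  move: nuj; rewrite /upper_marks/= jn' /= in_itv/= andbT => /negP; rewrite -leNgt.
  by rewrite -natr1 mulrDl mul1r.
rewrite /Num.min; case: ltP => h1; case: ltP => h2; rewrite ler_norml; apply/andP; split; lra.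
Qed.

Lemma mark_cell_prob (nu : R.-pker R ~> R) t j : fine (nu t (mark_cell j)) =
  fine (nu t (upper_marks j)) - fine (nu t (upper_marks j.+1)).
Proof.
rewrite -fineB ?pker_fin//; last 2 first.
- exact: measurable_upper_marks.
- exact: measurable_upper_marks.
congr fine; rewrite /mark_cell measureD; try exact: measurable_upper_marks.
  by rewrite (setIidr (@upper_marksS j)).
by rewrite -ge0_fin_numE// pker_fin//; exact: measurable_upper_marks.
Qed.

(** The weight (1 + r)^(-1 - alpha) of the tail estimate is at most 1.  In cell 0
    a nonnegative time is the reference time itself. *)
Lemma mark_cell_lip (nu : R.-pker R ~> R) (c alpha : R) i j s :
  (forall r s t, 0 < r -> 0 < s -> s < t ->
     `|ccdf_ker nu s r - ccdf_ker nu t r| <=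
     c * (1 + r) `^ (-1 - alpha) * (t - s)) ->
  0 < c -> 0 < alpha -> 0 <= s -> time_cell i s ->
  `|fine (nu s (mark_cell j)) - fine (nu (time_point i) (mark_cell j))| <=
   2 * c * mesh m.
Proof.
move=> lipF c0 a0 s0 sI; have d0 := mesh_gt0 m.
have [s00|sn0] := eqVneq s 0.
  have -> : time_point i = s; last by rewrite subrr normr0 !mulr_ge0// ltW.
  rewrite s00; apply/eqP; rewrite eq_le; apply/andP; split; last first.
    by rewrite mulr_ge0// ltW.
  move: sI; rewrite /time_cell /time_point s00/= in_itv/= => /andP[+ _].
  rewrite pmulr_llt0// subr_lt0 => i1.
  have -> : (i : nat) = 0%N by apply/eqP; move: i1; rewrite -[1]/(1%:R) ltr_nat ltnS leqn0.
  by rewrite mul0r.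
have {}s0 : 0 < s by rewrite lt_def sn0.
have st : s <= time_point i by move: sI; rewrite /time_cell/= in_itv/= => /andP[].
have std : time_point i - s <= mesh m.
  by have := time_cell_dist sI; rewrite distrC => /(le_trans (ler_norm _)).
have lipU k : `|fine (nu s (upper_marks k)) -
    fine (nu (time_point i) (upper_marks k))| <= c * mesh m.
  have cd : 0 <= c * mesh m by rewrite mulr_ge0// ltW.
  rewrite /upper_marks; case: eqVneq => [_|k0].
    by rewrite !prob_kernel subrr normr0.
  case: ifP => _; last by rewrite !measure0 subrr normr0.
  have [->|sti] := eqVneq s (time_point i); first by rewrite subrr normr0.
  have {}sti : s < time_point i by rewrite lt_neqAle sti.
  have r0 : 0 < k%:R * mesh n by rewrite mulr_gt0 ?mesh_gt0// ltr0n lt0n.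
  apply: le_trans (lipF _ _ _ r0 s0 sti) _.
  rewrite -mulrA; apply: ler_wpM2l; first exact: ltW.
  apply: (@le_trans _ _ (1 * (time_point i - s))); last by rewrite mul1r.
  rewrite ler_wpM2r ?subr_ge0//.
  rewrite -[leRHS](powRr0 (1 + k%:R * mesh n)) ler_powR//; lra.
rewrite !mark_cell_prob; have := lipU j; have := lipU j.+1.
rewrite !ler_norml => /andP[? ?] /andP[? ?].
by apply/andP; split; lra.
Qed.

Lemma sum_mark_cell (nu : R.-pker R ~> R) s :
  \sum_j fine (nu s (mark_cell j)) = 1.
Proof.
pose f k := - fine (nu s (upper_marks k)).
transitivity (\sum_(0 <= k < n.+2) (f k.+1 - f k)).
  rewrite big_mkord; apply: eq_bigr => j _; rewrite mark_cell_prob /f; ring.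
rewrite telescope_sumr// /f /upper_marks/= ltnn prob_kernel measure0/=; ring.
Qed.

End grid.

(** * Mean numbers of points in the cells *)

Lemma limit_mean_rect (R : realType) (lambda : R -> R) (nu : R.-pker R ~> R)
    (zbar : R) (B C : set R) : measurable C ->
  limit_mean lambda nu zbar (B `*` C) =
  (\int[lebesgue_measure]_(s in B `&` `[0%R, +oo[)
     (zbar * lambda s * fine (nu s C))%:E)%E.
Proof.
move=> mC; rewrite /limit_mean integral_mkcondl; apply: eq_integral => s _.
rewrite /patch; case: ifPn => sB.
  by rewrite in_xsectionX// [RHS]EFinM fineK// pker_fin.
by rewrite notin_xsectionX// measure0 mule0.
Qed.

Section cell_means.
Context (R : realType).
Local Notation leb := (@lebesgue_measure R).
Context (T K c alpha zbar : R) (m n : nat) (lambda : R -> R) (nu : R.-pker R ~> R).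
Hypotheses (T0 : 0 < T) (K0 : 0 < K) (c0 : 0 < c) (alpha0 : 0 < alpha)
  (zbarK : 0 <= zbar <= K)
  (clambda : {within `[0, +oo[, continuous lambda})
  (lambdaK : forall s, 0 <= s -> 0 <= lambda s <= K)
  (lipF : forall r s t, 0 < r -> 0 < s -> s < t ->
     `|ccdf_ker nu s r - ccdf_ker nu t r| <=
     c * (1 + r) `^ (-1 - alpha) * (t - s)).

Local Notation tcell i := (@time_cell R T m i).
Local Notation mcell j := (@mark_cell R T n j).

(** The points have nonnegative times; the part of cell 0 below 0 is cut off because
    the bounds on lambda hold at nonnegative times. *)
Definition live_cell (i : 'I_m.+2) : set R := tcell i `&` `[0, +oo[%classic.

Lemma measurable_live_cell i : measurable (live_cell i).
Proof. by apply: measurableI; exact: measurable_itv. Qed.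

Lemma live_cell_sub i : live_cell i `<=` `[0, +oo[%classic.
Proof. by move=> s []. Qed.

Lemma live_cell_measure i : (leb (live_cell i) <= (mesh T m)%:E)%E.
Proof.
apply: (@le_trans _ _ (leb (tcell i))).
  apply: le_measure; last by move=> s [].
    by apply/mem_set; exact: measurable_live_cell.
  by apply/mem_set; exact: measurable_itv.
rewrite /time_cell lebesgue_measure_itv/= lte_fin; case: ifPn => _; last first.
  by rewrite lee_fin ltW// mesh_gt0.
by rewrite -EFinB lee_fin; lra.
Qed.

Lemma live_cell_integrable i (f : R -> R) (M : R) :
  measurable_fun (`[0, +oo[%classic : set R) f ->
  (forall s, 0 <= s -> `|f s| <= M) -> leb.-integrable (live_cell i) (EFin \o f).
Proof.
move=> mf fM; apply: measurable_bounded_integrable.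
- exact: measurable_live_cell.
- by rewrite (le_lt_trans (live_cell_measure i))// ltry.
- by apply: measurable_funS mf => //; exact: live_cell_sub.
- exists M; split; first exact: num_real.
  move=> x Mx s /live_cell_sub; rewrite /= in_itv/= andbT => s0.
  by apply: le_trans (fM s s0) _; exact: ltW.
Qed.

Let ml : measurable_fun (`[0, +oo[%classic : set R) lambda.
Proof. exact: subspace_continuous_measurable_fun. Qed.

(** Mean number of arrivals of the limiting queue in a time cell. *)
Definition cell_mean (i : 'I_m.+2) : R :=
  \int[leb]_(s in live_cell i) (zbar * lambda s).

(** Mean number of limiting points in a product cell. *)
Definition mark_mean (i : 'I_m.+2) (j : 'I_n.+2) : R :=
  \int[leb]_(s in live_cell i) (zbar * lambda s * fine (nu s (mcell j))).

Let base_ge0 s : 0 <= s -> 0 <= zbar * lambda s <= K * K.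
Proof.
move=> s0; have /andP[? ?] := lambdaK s0; case/andP: zbarK => ? ?.
by rewrite mulr_ge0//= ler_pM.
Qed.

Lemma base_integrable i : leb.-integrable (live_cell i) (EFin \o (fun s => zbar * lambda s)).
Proof.
apply: (@live_cell_integrable _ _ (K * K)); first exact: measurable_funM.
by move=> s /base_ge0 /andP[? ?]; rewrite ger0_norm.
Qed.

Lemma measurable_mark_prob j : measurable_fun setT (fun s => fine (nu s (mcell j))).
Proof.
apply: (measurableT_comp (fine_measurable measurableT)).
exact: (measurable_kernel nu _ (measurable_mark_cell T j)).
Qed.

Lemma measurable_mark_mass j : measurable_fun (`[0, +oo[%classic : set R)
  (fun s => zbar * lambda s * fine (nu s (mcell j))).
Proof.
apply: measurable_funM; first exact: measurable_funM.
exact: measurable_funTS (measurable_mark_prob j).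
Qed.

Lemma mark_integrable i j : leb.-integrable (live_cell i)
  (EFin \o (fun s => zbar * lambda s * fine (nu s (mcell j)))).
Proof.
apply: (@live_cell_integrable _ _ (K * K)); first exact: measurable_mark_mass.
move=> s /base_ge0 /andP[b0 bK].
have /andP[? ?] := pker01 nu s (measurable_mark_cell T j).
rewrite ger0_norm; last by apply: mulr_ge0.
by apply: le_trans bK; rewrite ler_piMr.
Qed.

Lemma limit_mean_cell i j :
  limit_mean lambda nu zbar (tcell i `*` mcell j) = (mark_mean i j)%:E.
Proof.
rewrite limit_mean_rect; last exact: measurable_mark_cell.
by rewrite /mark_mean /Rintegral fineK// integrable_fin_num//;
  [exact: measurable_live_cell|exact: mark_integrable].
Qed.

Lemma mark_mean_ge0 i j : 0 <= mark_mean i j.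
Proof.
apply: Rintegral_ge0 => s /live_cell_sub; rewrite /= in_itv/= andbT => s0.
have /andP[? ?] := base_ge0 s0.
by have /andP[? ?] := pker01 nu s (measurable_mark_cell T j); rewrite mulr_ge0.
Qed.

Lemma cell_mean_ge0 i : 0 <= cell_mean i.
Proof.
apply: Rintegral_ge0 => s /live_cell_sub; rewrite /= in_itv/= andbT => s0.
by have /andP[? ?] := base_ge0 s0.
Qed.

Lemma cell_mean_le i : cell_mean i <= K * K * mesh T m.
Proof.
have lf : leb (live_cell i) \is a fin_num.
  by rewrite ge0_fin_numE// (le_lt_trans (live_cell_measure i))// ltry.
apply: (@le_trans _ _ (\int[leb]_(s in live_cell i) (K * K))).
  apply: le_Rintegral; [exact: measurable_live_cell|exact: base_integrable| |].
    apply: (@live_cell_integrable _ _ (K * K)); first exact: measurable_cst.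
    by move=> s _; rewrite ger0_norm// mulr_ge0// ltW.
  by move=> s /live_cell_sub; rewrite /= in_itv/= andbT => /base_ge0/andP[].
rewrite Rintegral_cst; last exact: measurable_live_cell.
apply: ler_wpM2l; first by rewrite mulr_ge0// ltW.
by rewrite -lee_fin fineK//; exact: live_cell_measure.
Qed.

(** The mark probabilities at each time sum to 1. *)
Lemma sum_mark_mean i : \sum_j mark_mean i j = cell_mean i.
Proof.
rewrite /mark_mean /cell_mean.
have h (r : seq 'I_n.+2) : \sum_(j <- r) mark_mean i j =
    \int[leb]_(s in live_cell i) (\sum_(j <- r) zbar * lambda s * fine (nu s (mcell j))) /\
    leb.-integrable (live_cell i) (EFin \o (fun s =>
       \sum_(j <- r) zbar * lambda s * fine (nu s (mcell j)))).
  elim: r => [|j r [IH1 IH2]].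
    split.
      rewrite big_nil; under eq_Rintegral do rewrite big_nil.
      by rewrite Rintegral_cst ?mul0r//; exact: measurable_live_cell.
    apply: (@live_cell_integrable _ _ 0) => [|s _]; last by rewrite big_nil normr0.
    by apply: measurable_sum => j; exact: measurable_mark_mass.
  split.
    rewrite big_cons IH1; under [RHS]eq_Rintegral do rewrite big_cons.
    by rewrite RintegralD//; [exact: measurable_live_cell|exact: mark_integrable].
  rewrite (_ : _ \o _ = ((EFin \o (fun s : R => (zbar * lambda s * fine (nu s (mcell j)))%R)) \+
     (EFin \o (fun s : R => (\sum_(j <- r) zbar * lambda s * fine (nu s (mcell j)))%R)))%E).
    by apply: integrableD => //; [exact: measurable_live_cell|exact: mark_integrable].
  by apply/funext => s /=; rewrite big_cons EFinD.
rewrite (h _).1; apply: eq_Rintegral => s _.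
by rewrite -mulr_sumr sum_mark_cell// mulr1.
Qed.

Lemma mark_mean_approx i j :
  `|mark_mean i j - fine (nu (time_point T i) (mcell j)) * cell_mean i| <=
   2 * c * mesh T m * cell_mean i.
Proof.
set p := fine _; set eta := 2 * c * _.
have mD := measurable_live_cell i.
have iS k : leb.-integrable (live_cell i) (EFin \o (fun s => k * (zbar * lambda s))).
  apply: (@live_cell_integrable _ _ (`|k| * (K * K))).
    by apply: measurable_funM => //; exact: measurable_funM.
  by move=> s /base_ge0 /andP[? ?]; rewrite normrM ler_wpM2l// ger0_norm.
have eS k : k * cell_mean i = \int[leb]_(s in live_cell i) (k * (zbar * lambda s)).
  by rewrite RintegralZl//; exact: base_integrable.
have close s : live_cell i s -> `|fine (nu s (mcell j)) - p| <= eta /\ 0 <= zbar * lambda s.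
  move=> [si]; rewrite /= in_itv/= andbT => s0; split; last by case/andP: (base_ge0 s0).
  exact: mark_cell_lip lipF c0 alpha0 s0 si.
have up : mark_mean i j <= (p + eta) * cell_mean i.
  rewrite eS; apply: le_Rintegral => //; first exact: mark_integrable.
  move=> s /close[+ b0]; rewrite ler_norml => /andP[_ h].
  by rewrite mulrC ler_wpM2r//; lra.
have lo : (p - eta) * cell_mean i <= mark_mean i j.
  rewrite eS; apply: le_Rintegral => //; first exact: mark_integrable.
  move=> s /close[+ b0]; rewrite ler_norml => /andP[h _].
  by rewrite [leRHS]mulrC ler_wpM2r//; lra.
by rewrite ler_norml; apply/andP; split; lra.
Qed.

(** Mean number of arrivals in a time cell when the intensity follows the
    environment z at speed 1 / eps. *)
Definition fast_mean (z : R -> R) (eps : R) (i : 'I_m.+2) : R :=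
  \int[leb]_(s in live_cell i) (lambda s * z (s / eps)).

Lemma fast_meanE (z : R -> R) eps i :
  measurable_fun (`[0, +oo[%classic : set R) z ->
  (forall u, 0 <= u -> 0 <= z u <= K) -> 0 < eps ->
  (\int[leb]_(s in tcell i `&` `[0%R, +oo[) (lambda s * z (s / eps)%R)%:E)%E =
  (fast_mean z eps i)%:E /\ 0 <= fast_mean z eps i.
Proof.
move=> mz zK e0; have mD : measurable (`[0, +oo[%classic : set R) by [].
have zs s : 0 <= s -> 0 <= lambda s * z (s / eps) <= K * K.
  move=> s0; have /andP[? ?] := lambdaK s0.
  by have /andP[? ?] := zK _ (divr_ge0 s0 (ltW e0)); rewrite mulr_ge0//= ler_pM.
split; last first.
  apply: Rintegral_ge0 => s /live_cell_sub; rewrite /= in_itv/= andbT => s0.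
  by have /andP[] := zs s s0.
rewrite /fast_mean /Rintegral fineK// integrable_fin_num//.
  exact: measurable_live_cell.
apply: (@live_cell_integrable _ _ (K * K)); last first.
  by move=> s /zs /andP[? ?]; rewrite ger0_norm.
apply: measurable_funM => //.
have mg : measurable_fun (`[0, +oo[%classic : set R) (fun s : R => s / eps).
  exact: measurable_funTS (measurable_divr eps).
refine (measurable_comp mD _ mz mg).
by move=> _ [s /= + <-]; rewrite !in_itv/= !andbT => s0; rewrite divr_ge0// ltW.
Qed.

Lemma cvg_fast_mean (z : R -> R) i :
  measurable_fun (`[0, +oo[%classic : set R) z ->
  (forall u, 0 <= u -> 0 <= z u <= K) ->
  (t^-1 * \int[leb]_(u in `[0, t]) z u) @[t --> +oo] --> zbar ->
  fast_mean z eps i @[eps --> 0^'+] --> cell_mean i.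
Proof.
move=> mz zK zavg; have d0 := mesh_gt0 T0 m.
(* the cell at the origin reduces to {0} and has mean 0 on both sides *)
have [i0|i0] := eqVneq (i : nat) 0%N.
  have E : live_cell i = [set 0].
    rewrite /live_cell /time_cell i0 mul0r sub0r mulN1r; apply/seteqP; split => s /=.
      by rewrite !in_itv/= andbT => -[/andP[_ ?] ?]; apply/eqP; rewrite eq_le; apply/andP.
    by move=> ->; rewrite !in_itv/= !lexx andbT oppr_lt0.
  rewrite /fast_mean /cell_mean E; under eq_fun do rewrite Rintegral_set1.
  by rewrite Rintegral_set1; exact: cvg_cst.
have i1 : 1 <= (i : nat)%:R :> R by rewrite ler1n lt0n.
have a0 : 0 <= ((i : nat)%:R - 1) * mesh T m by rewrite mulr_ge0 ?subr_ge0// ltW.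
have E : live_cell i = tcell i.
  apply/setIidPl => s; rewrite /time_cell/= !in_itv/= andbT => /andP[? _]; lra.
rewrite /fast_mean /cell_mean E.
apply: (@cvg_fast_intensity _ _ _ K) => //.
by rewrite ler_pM2r//; lra.
Qed.

End cell_means.

(** * Convergence in a fixed environment *)

Local Notation conf m n := {ffun 'I_m.+2 -> option 'I_n.+2}.

Lemma cvg_time_weight (R : realType) (I J : finType) (T : Type)
    (F : set_system T) (FF : Filter F) (mu : T -> I -> R) (mu0 : I -> R)
    (sigma : {ffun I -> option J}) :
  (forall i, mu x i @[x --> F] --> mu0 i) ->
  time_weight (mu x) sigma @[x --> F] --> time_weight mu0 sigma.
Proof.
move=> cmu; rewrite /time_weight; apply: cvg_big => [|i _]; first exact: mul_continuous.
rewrite /poisson01; apply: cvgM.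
  apply: (@cvg_comp _ _ _ _ expR _ (nbhs (- mu0 i))); last exact: continuous_expR.
  exact: cvgN.
case: (isSome _); first exact: cmu.
under eq_fun do rewrite expr0.
by rewrite expr0; exact: cvg_cst.
Qed.

Section fixed_environment.
Context (R : realType) (dO dO' : measure_display) (Omega : measurableType dO)
  (Omega' : measurableType dO') (Q : probability Omega R) (P : probability Omega' R).
Context (lambda z : R -> R) (K c alpha zbar T : R) (nu : R.-pker R ~> R).
Context (Gam : R -> nat -> Omega -> \bar R) (L : R -> nat -> Omega -> R)
  (Gam0 : nat -> Omega' -> \bar R) (L0 : nat -> Omega' -> R).
Hypotheses (T0 : 0 < T) (K0 : 0 < K) (c0 : 0 < c) (alpha0 : 0 < alpha)
  (clambda : {within `[0, +oo[, continuous lambda})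
  (lambdaK : forall s, 0 <= s -> 0 <= lambda s <= K)
  (lipF : forall r s t, 0 < r -> 0 < s -> s < t ->
     `|ccdf_ker nu s r - ccdf_ker nu t r| <=
     c * (1 + r) `^ (-1 - alpha) * (t - s))
  (mz : measurable_fun (`[0, +oo[%classic : set R) z)
  (zK : forall u, 0 <= u -> 0 <= z u <= K)
  (zbarK : 0 <= zbar <= K)
  (zavg : (t^-1 * \int[@lebesgue_measure R]_(u in `[0, t]) z u) @[t --> +oo] --> zbar).
Hypotheses (pts : forall eps, 0 < eps -> marked_points (Gam eps) (L eps))
  (pts_law : forall eps, 0 < eps -> poisson_random_measure Q
     (fun B : set R => (\int[@lebesgue_measure R]_(s in B `&` `[0%R, +oo[)
        (lambda s * z (s / eps)%R)%:E)%E) (time_count (Gam eps)))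
  (marks_law : forall eps, 0 < eps -> conditional_marks Q nu (Gam eps) (L eps))
  (pts0 : marked_points Gam0 L0)
  (pts0_law : poisson_random_measure P (limit_mean lambda nu zbar)
     (marked_count Gam0 L0)).

Section one_grid.
Context (m n : nat).
Local Notation cI := (@time_cell R T m).
Local Notation cJ := (@mark_cell R T n).
Local Notation mu1 := (@cell_mean R T zbar m lambda).
Local Notation mu2 := (@mark_mean R T zbar m n lambda nu).
Implicit Types sigma : conf m n.

Definition limit_prob sigma : R := fine (P (config cI cJ Gam0 L0 sigma)).
Definition fast_prob eps sigma : R := fine (Q (config cI cJ (Gam eps) (L eps) sigma)).

Lemma limit_probE sigma : limit_prob sigma = cell_weight mu2 sigma.
Proof.
rewrite /limit_prob /cell_weight.
pose B (ij : 'I_m.+2 * 'I_n.+2) := cI ij.1 `*` cJ ij.2.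
have mB ij : measurable (B ij).
  by apply: measurableX; [exact: measurable_time_cell|exact: measurable_mark_cell].
have BE ij : limit_mean lambda nu zbar (B ij) = (mu2 ij.1 ij.2)%:E.
  by apply: (@limit_mean_cell _ _ K).
have tB : trivIset setT B.
  move=> [i j] [i' j'] _ _ [[s l] [[/= si lj] [/= si' lj']]].
  have -> : i = i' by apply: (trivIset_time_cell T0 (m := m)) => //; exists s.
  by have -> : j = j' by apply: (trivIset_mark_cell T0 (n := n)) => //; exists l.
rewrite /config (poisson_config (fun ij => sigma ij.1 == Some ij.2) pts0_law mB _ _ tB)/=.
- by apply: eq_bigr => ij _; rewrite BE.
- by move=> ij; rewrite BE.
- by move=> ij; rewrite BE lee_fin (@mark_mean_ge0 _ _ K).
Qed.

Lemma fast_time_prob eps sigma : 0 < eps ->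
  fine (Q (time_config cI (Gam eps) sigma)) =
  time_weight (@fast_mean R T m lambda z eps) sigma.
Proof.
move=> e0; have E i := @fast_meanE _ _ _ m _ T0 clambda lambdaK z eps i mz zK e0.
rewrite /time_config (poisson_config (fun i => isSome (sigma i)) (pts_law e0) (B := cI)).
- by rewrite /=; apply: eq_bigr => i _; rewrite (E i).1.
- exact: measurable_time_cell.
- by move=> i; rewrite (E i).1.
- by move=> i; rewrite (E i).1 lee_fin (E i).2.
- exact: trivIset_time_cell.
Qed.

Let eta := 2 * c * mesh T m.

(** Both probabilities are compared with a Poisson weight of the times multiplied
    by mark probabilities at fixed times.  The two weights differ only through
    the means of the time cells, which converge, so that the bound that survives is
    twice the marking error of the limit. *)
Lemma fast_prob_near zeta : 0 < zeta -> \forall eps \near 0^'+,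
  \sum_(sigma : conf m n) `|fast_prob eps sigma - limit_prob sigma| <=
  2 * eta * expR ((2 * n.+2)%:R * \sum_i mu1 i) + zeta.
Proof.
move=> zeta0.
pose N sigma : R := \sum_i (isSome (sigma i))%:R.
pose p i j := fine (nu (@time_point R T m i) (cJ j)).
have p01 i j : 0 <= p i j <= 1 by apply: pker01; exact: measurable_mark_cell.
have eta0 : 0 <= eta by rewrite !mulr_ge0// ?ltW// mesh_gt0.
have N0 sigma : 0 <= N sigma by apply: sumr_ge0.
have mu1_0 i : 0 <= mu1 i by apply: (@cell_mean_ge0 _ _ K).
have lw01 sigma : 0 <= label_weight p sigma <= 1.
  apply/andP; split; first by apply: prodr_ge0 => i _; case/andP: (mark_weight01 (sigma i) (p01 i)).
  by apply: prodr_ile1 => i _; apply: mark_weight01.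
have cvgW : (\sum_(sigma : conf m n) (eta * N sigma + 1) *
    `|time_weight (@fast_mean R T m lambda z eps) sigma - time_weight mu1 sigma|)
    @[eps --> 0^'+] --> (0 : R).
  rewrite [X in _ --> X](_ : 0 = \sum_(sigma : conf m n) (0 : R)); last first.
    by rewrite big1.
  apply: cvg_big => [|sigma _]; first exact: add_continuous.
  rewrite -[X in _ --> X](mulr0 (eta * N sigma + 1)); apply: cvgMr.
  have h : (time_weight (@fast_mean R T m lambda z eps) sigma - time_weight mu1 sigma)
      @[eps --> 0^'+] --> time_weight mu1 sigma - time_weight mu1 sigma.
    apply: cvgB; last exact: cvg_cst.
    by apply: cvg_time_weight => i; apply: (@cvg_fast_mean _ _ K).
  rewrite subrr in h; have h' := cvg_norm h; rewrite normr0 in h'.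
  exact: h'.
have /cvgrPdist_le/(_ _ zeta0) near0 := cvgW.
near=> eps.
have e0 : 0 < eps by near: eps; exact: nbhs_right_gt.
have nearW : \sum_(sigma : conf m n) (eta * N sigma + 1) *
    `|time_weight (@fast_mean R T m lambda z eps) sigma - time_weight mu1 sigma| <= zeta.
  have : `|0 - \sum_(sigma : conf m n) (eta * N sigma + 1) *
    `|time_weight (@fast_mean R T m lambda z eps) sigma - time_weight mu1 sigma| | <= zeta.
    by near: eps.
  by rewrite sub0r normrN; apply: le_trans; exact: ler_norm.
have sumN := @sum_time_weight R _ 'I_n.+2 mu1 mu1_0; rewrite card_ord in sumN.
apply: (@le_trans _ _ (\sum_(sigma : conf m n)
   ((eta * N sigma + 1) *
     `|time_weight (@fast_mean R T m lambda z eps) sigma - time_weight mu1 sigma|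
    + 2 * eta * (N sigma * time_weight mu1 sigma)))); last first.
  rewrite big_split/= addrC lerD// -mulr_sumr ler_wpM2l//.
  by rewrite mulr_ge0.
apply: ler_sum => sigma _; set W := time_weight mu1 sigma.
set We := time_weight _ sigma.
have h1 : `|fast_prob eps sigma - label_weight p sigma * We| <= eta * N sigma * We.
  rewrite /We -(fast_time_prob _ e0).
  apply: (@config_approx_time _ _ _ _ _ _ _ _ _ _ _ _ _ _ _ Q nu) => //.
  - exact: measurable_time_cell.
  - exact: trivIset_time_cell.
  - exact: measurable_mark_cell.
  - exact: trivIset_mark_cell.
  - exact: mark_cell_cover.
  - exact: pts.
  - exact: marks_law.
  - by move=> i j s s0 si; exact: mark_cell_lip lipF c0 alpha0 s0 si.
have h2 : `|limit_prob sigma - label_weight p sigma * W| <= eta * N sigma * W.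
  rewrite limit_probE; apply: cell_weight_approx => //.
  - by move=> i j; apply: (@mark_mean_ge0 _ _ K).
  - by move=> i; apply: (@sum_mark_mean _ _ K).
  - by move=> i j; apply: (@mark_mean_approx _ _ K _ alpha).
have /andP[l0 l1] := lw01 sigma; have Ns := N0 sigma.
have h3 : eta * N sigma * We <= eta * N sigma * W + eta * N sigma * `|We - W|.
  have WW : We <= W + `|We - W| by have := ler_norm (We - W); lra.
  by rewrite -mulrDr; apply: ler_wpM2l => //; rewrite mulr_ge0.
have h4 : `|label_weight p sigma * We - label_weight p sigma * W| <= `|We - W|.
  by rewrite -mulrBr normrM ger0_norm// ler_piMl.
have -> : fast_prob eps sigma - limit_prob sigma =
  (fast_prob eps sigma - label_weight p sigma * We) +
  (label_weight p sigma * We - label_weight p sigma * W) +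
  (label_weight p sigma * W - limit_prob sigma) by ring.
rewrite (le_trans (ler_normD _ _))//; rewrite distrC in h2.
apply: (@le_trans _ _ (eta * N sigma * We + `|We - W| + eta * N sigma * W)).
  by rewrite lerD// (le_trans (ler_normD _ _))// lerD.
by lra.
Unshelve. all: by end_near.
Qed.

Lemma sum_limit_prob : 1 - \sum_i mu1 i ^+ 2 <=
  \sum_(sigma : conf m n) limit_prob sigma.
Proof.
rewrite (eq_bigr _ (fun sigma _ => limit_probE sigma)).
apply: sum_cell_weight => i; first by apply: (@cell_mean_ge0 _ _ K).
by apply: (@sum_mark_mean _ _ K).
Qed.

End one_grid.

Let leq_double m : m.+2%:R <= 2 * m.+1%:R :> R.
Proof. by rewrite -natrM ler_nat mulSn mul1n addSn addnS !ltnS leq_addr. Qed.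

Let mean_total m : K * K * T = K * K * mesh T m * m.+1%:R.
Proof. by rewrite /mesh -[RHS]mulrA divfK ?pnatr_eq0. Qed.

Let mean_ge0 m : 0 <= K * K * mesh T m.
Proof. by rewrite !mulr_ge0// ltW// mesh_gt0. Qed.

Lemma sum_cell_mean m : \sum_(i < m.+2) cell_mean T zbar lambda i <= 2 * (K * K * T).
Proof.
apply: (@le_trans _ _ (\sum_(i < m.+2) K * K * mesh T m)).
  by apply: ler_sum => i _; apply: (@cell_mean_le _ _ K).
rewrite sumr_const card_ord -[leLHS]mulr_natr (mean_total m) [leRHS]mulrCA.
by apply: ler_wpM2l; [exact: mean_ge0|exact: leq_double].
Qed.

Lemma sum_cell_mean_sqr m : \sum_(i < m.+2) cell_mean T zbar lambda i ^+ 2 <=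
  2 * (K * K * T) ^+ 2 / m.+1%:R.
Proof.
apply: (@le_trans _ _ (\sum_(i < m.+2) (K * K * mesh T m) ^+ 2)).
  apply: ler_sum => i _; rewrite lerXn2r ?nnegrE//.
    by apply: (@cell_mean_ge0 _ _ K).
  by apply: (@cell_mean_le _ _ K).
rewrite sumr_const card_ord -[leLHS]mulr_natr (mean_total m).
rewrite (_ : 2 * _ / _ = (K * K * mesh T m) ^+ 2 * (2 * m.+1%:R)).
  by apply: ler_wpM2l; [exact/exprn_ge0/mean_ge0|exact: leq_double].
by field; rewrite addrC natr1 pnatr_eq0.
Qed.

(** For n fixed the exponential is bounded uniformly in m, while the time mesh
    goes to 0. *)
Lemma fine_time_grid n : exists2 m, (n <= m)%N &
  2 * (2 * c * mesh T m) *
    expR ((2 * n.+2)%:R * \sum_(i < m.+2) cell_mean T zbar lambda i) <= n.+1%:R^-1.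
Proof.
set e := expR ((2 * n.+2)%:R * (2 * (K * K * T))).
set B := 2 * (2 * c * T) * e * n.+1%:R.
have B0 : 0 <= B by rewrite !mulr_ge0 ?expR_ge0 ?ltW.
exists (maxn n (Num.truncn B)); first exact: leq_maxl.
set m := maxn _ _.
have Bm : B <= m.+1%:R.
  apply: (@le_trans _ _ (Num.truncn B).+1%:R); first exact/ltW/truncnS_gt.
  by rewrite ler_nat ltnS leq_maxr.
apply: (@le_trans _ _ (2 * (2 * c * mesh T m) * e)).
  apply: ler_wpM2l; first by rewrite !mulr_ge0// ltW// mesh_gt0.
  by rewrite ler_expR; apply: ler_wpM2l => //; exact: sum_cell_mean.
rewrite -[leRHS]mul1r ler_pdivlMr// [leLHS](_ : _ = B / m.+1%:R); last first.
  by rewrite /mesh /B; move: (e) => e0; set x := n.+1%:R; set y := m.+1%:R^-1; ring.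
by rewrite ler_pdivrMr// mul1r.
Qed.

Lemma config_path_CT (I J : finType) (a : I -> R) (r : J -> R)
    (sigma : {ffun I -> option J}) : CT T (config_path a r sigma).
Proof.
rewrite /CT /=; apply: continuous_subspaceT => t; rewrite /config_path.
apply: cvg_big => [|i _]; first exact: add_continuous.
by case: (sigma i) => [j|]; [exact: continuous_served|exact: cvg_cst].
Qed.

Section one_functional.
Context (phi : {uniform` `[0, T] -> R} -> R) (theta : R).
Hypotheses (cphi : {within CT T, continuous phi}) (theta0 : 0 < theta).

Definition grid_path m n (sigma : conf m n) : R -> R :=
  config_path (@time_point R T m) (@mark_point R T n) sigma.

(** The condition concerns phi and the grid alone, so the same configurations are
    bad for the fast and for the limiting queue. *)
Definition good_config m n (sigma : conf m n) : Prop :=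
  forall f : R -> R, CT T f ->
    (forall t, 0 <= t <= T ->
      `|f t - grid_path sigma t| <= mesh T n *+ 2 *+ config_size sigma) ->
    `|phi f - phi (grid_path sigma)| <= theta.

Definition bad_event m n : set Omega' :=
  [set w | exists2 sigma : conf m n,
    ~ good_config sigma & config (@time_cell R T m) (@mark_cell R T n) Gam0 L0 sigma w].

Lemma grid_config_arrivals (dW : measure_display) (W : measurableType dW)
    (G : nat -> W -> \bar R) (M : nat -> W -> R) m n
    (sigma : conf m n) w : (n <= m)%N ->
  marked_points G M -> config (@time_cell R T m) (@mark_cell R T n) G M sigma w ->
  [/\ finite_set (arrived G T w), #|` fset_set (arrived G T w)|%fset = config_size sigma &
   forall t, 0 <= t <= T ->
    `|finite_input G M T w t - grid_path sigma t| <= mesh T n *+ 2 *+ config_size sigma].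
Proof.
move=> nm pGM; apply: config_arrivals => //.
- exact: trivIset_time_cell.
- exact: trivIset_mark_cell.
- exact: time_cell_cover.
- exact: mark_cell_cover.
- move=> i s /time_cell_dist/le_trans; apply.
  by apply: ler_wpM2l; [exact: ltW|rewrite lef_pV2 ?posrE// ler_nat ltnS].
- exact: mark_cell_dist.
Qed.

Lemma measurable_bad_event m n : measurable (bad_event m n).
Proof.
rewrite (_ : bad_event m n = \bigcup_(sigma in
   [set sigma : conf m n | ~ good_config sigma])
   config (@time_cell R T m) (@mark_cell R T n) Gam0 L0 sigma); last first.
  by apply/seteqP; split => w [sigma]; exists sigma.
apply: fin_bigcup_measurable; first exact: finite_finset.
move=> sigma _; apply: measurable_config => //.
- exact: measurable_time_cell.
- exact: measurable_mark_cell.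
Qed.

(** The path A and the path of its configuration are close, so a path close to the
    latter is close to A, and phi is continuous at A. *)
Lemma bad_event_eventually w : finite_set (arrived Gam0 T w) ->
  exists n0, forall n m, (n0 <= n)%N -> (n <= m)%N -> ~ bad_event m n w.
Proof.
move=> fA; set N := #|` fset_set (arrived Gam0 T w)|%fset.
have CA : CT T (finite_input Gam0 L0 T w).
  rewrite /CT /=; apply: continuous_subspaceT; exact: continuous_sum_served.
have th2 : 0 < theta / 2 by rewrite divr_gt0.
have [r r0 hr] := CT_continuity cphi CA th2.
(* a path compatible with the configuration is within 4 N mesh of A *)
pose n0 := Num.truncn (4 * T * N%:R / r).
have small n : (n0 <= n)%N -> mesh T n *+ 2 *+ N *+ 2 < r.
  move=> n0n; have : 4 * T * N%:R / r < n.+1%:R.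
    by apply: lt_le_trans (truncnS_gt _) _; rewrite ler_nat ltnS.
  rewrite ltr_pdivrMr// => h.
  rewrite (_ : _ *+ 2 *+ N *+ 2 = 4 * T * N%:R / n.+1%:R); last first.
    rewrite -2!mulrnA -[LHS]mulr_natr !natrM /mesh; move: (N%:R) => x.
    by move: (n.+1%:R^-1) => y; ring.
  by rewrite ltr_pdivrMr// [ltRHS]mulrC.
exists n0 => n m n0n nm [sigma ngood cw].
have [_ sN dist] := grid_config_arrivals nm pts0 cw.
apply: ngood => f Cf fx; have sm := small n n0n; rewrite -/N in sN.
rewrite -sN in fx dist; set D := mesh T n *+ 2 *+ N in sm fx dist.
have D0 : 0 <= D by rewrite !mulrn_wge0// ltW// mesh_gt0.
have h1 : `|phi (finite_input Gam0 L0 T w) - phi f| < theta / 2.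
  apply: hr => // t tT; have := fx t tT; have := dist t tT.
  have := ler_distD (grid_path sigma t) (finite_input Gam0 L0 T w t) (f t).
  by rewrite (distrC (grid_path sigma t)); lra.
have h2 : `|phi (finite_input Gam0 L0 T w) - phi (grid_path sigma)| < theta / 2.
  apply: hr => [|t tT]; first exact: config_path_CT.
  by apply: (le_lt_trans (dist t tT)); lra.
have := ler_distD (phi (finite_input Gam0 L0 T w)) (phi f) (phi (grid_path sigma)).
by rewrite (distrC (phi f) (phi (finite_input Gam0 L0 T w))); lra.
Qed.

Hypothesis finite_arrivals0 : {ae P, forall w, finite_set (arrived Gam0 T w)}.

(** An outcome with finitely many arrivals is in finitely many bad events, so the
    tails of the sequence of bad events decrease to a null set. *)
Lemma bad_event_small (mc : nat -> nat) : (forall n, (n <= mc n)%N) ->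
  forall zeta, 0 < zeta -> exists n1, forall n, (n1 <= n)%N ->
    fine (P (bad_event (mc n) n)) <= zeta.
Proof.
move=> mcn zeta zeta0.
pose F n := \bigcup_(k in [set k | (n <= k)%N]) bad_event (mc k) k.
have mF n : measurable (F n).
  by apply: bigcup_measurable => k _; exact: measurable_bad_event.
have mI : measurable (\bigcap_n F n) by exact: bigcapT_measurable.
have I0 : P (\bigcap_n F n) = 0%E.
  have [N [mN N0 subN]] := finite_arrivals0.
  apply/eqP; rewrite eq_le measure_ge0 andbT -N0.
  apply: le_measure; [exact/mem_set|exact/mem_set|].
  move=> w Fw; apply: subN => /= fA.
  have [n0 hn0] := bad_event_eventually fA.
  by have [k /= n0k bw] := Fw n0 I; exact: (hn0 k (mc k)) bw.
have ndF : {homo F : n k / (n <= k)%N >-> (k <= n)%O}.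
  move=> n k nk; apply/subsetPset => w [j /= kj bw]; exists j => //=.
  exact: leq_trans kj.
have PF0 : (P (F 0%N) < +oo)%E by rewrite -ge0_fin_numE// fin_num_measure.
have : P (F n) @[n --> \oo] --> 0%E.
  by rewrite -I0; exact: (nonincreasing_cvg_mu PF0 mF mI ndF).
move=> /fine_cvgP[_ /cvgrPdist_le/(_ _ zeta0)[n1 _ hn1]].
exists n1 => n n1n; have := hn1 n n1n; rewrite /= sub0r normrN => h.
apply: le_trans h; apply: le_trans (ler_norm _).
rewrite fine_le ?fin_num_measure//; first exact: measurable_bad_event.
apply: le_measure; [apply/mem_set; exact: measurable_bad_event|exact/mem_set|].
by move=> w bw; exists n => //=; exact: leqnn.
Qed.

(** On a bad configuration only the bound M on phi is available. *)
Definition config_error (M : R) m n (sigma : conf m n) : R :=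
  if `[< good_config sigma >] then theta else M + M.

Lemma grid_expectation (dW : measure_display) (W : measurableType dW)
    (U : probability W R) (G : nat -> W -> \bar R) (M : nat -> W -> R) (B : R) m n :
  (n <= m)%N -> marked_points G M ->
  (forall f : R -> R, CT T f -> `|phi f| <= B) ->
  let pr (sigma : conf m n) :=
    fine (U (config (@time_cell R T m) (@mark_cell R T n) G M sigma)) in
  exists2 x : R, expectation_CT U (total_input G M) phi = x%:E &
  `|x - \sum_sigma phi (grid_path sigma) * pr sigma| <=
    \sum_sigma config_error B sigma * pr sigma + B * (1 - \sum_sigma pr sigma).
Proof.
move=> nm pGM phiB pr.
have C0 : CT T (cst 0 : R -> R).
  by rewrite /CT /=; apply: continuous_subspaceT => t; exact: cvg_cst.
have B0 : 0 <= B by exact: le_trans (normr_ge0 _) (phiB _ C0).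
apply: integral_sandwich => //.
- move=> s; apply: measurable_config => //.
  + exact: measurable_time_cell.
  + exact: measurable_mark_cell.
- by move=> s s' w; exact: config_inj.
- by move=> w; exact: phiB.
move=> sigma w cw.
have [fA _ dist] := grid_config_arrivals nm pGM cw.
have CA := finite_arrivals_CT pGM fA; split => //.
rewrite /config_error; case: asboolP => [good|_].
  apply: good => // t tT.
  by rewrite (path_of_finite_input pGM fA tT); exact: dist.
rewrite (le_trans (ler_normB _ _))// lerD//; apply: phiB => //.
exact: config_path_CT.
Qed.

End one_functional.

(** The errors are summed over one grid, chosen from the limiting queue alone; eps
    tends to 0 with that grid fixed. *)
Lemma expectation_cvg (phi : {uniform` `[0, T] -> R} -> R) :
  {ae P, forall w, finite_set (arrived Gam0 T w)} ->
  {within CT T, continuous phi} ->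
  (exists M : R, forall f, CT T f -> `|phi f| <= M) ->
  expectation_CT Q (total_input (Gam eps) (L eps)) phi @[eps --> 0^'+] -->
  expectation_CT P (total_input Gam0 L0) phi.
Proof.
move=> fin0 cphi [B phiB].
have C0 : CT T (cst 0 : R -> R).
  by rewrite /CT /=; apply: continuous_subspaceT => t; exact: cvg_cst.
have B0 : 0 <= B by exact: le_trans (normr_ge0 _) (phiB _ C0).
have [x0 x0E _] := grid_expectation 1 P (leqnn 0) pts0 phiB.
rewrite x0E; apply/fine_cvgP; split.
  near=> eps; have e0 : 0 < eps by near: eps; exact: nbhs_right_gt.
  by have [x -> _] := grid_expectation 1 Q (leqnn 0) (pts e0) phiB.
apply/cvgrPdist_le => e e0.
(* twice theta, from the good configurations, takes e / 4; every other error is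
   at most a multiple of kap, and these multiples add up to at most Cst *)
pose theta := e / 8.
have theta0 : 0 < theta by rewrite divr_gt0.
pose X := (K * K * T) ^+ 2.
have X0 : 0 <= X by exact: sqr_ge0.
pose Cst := 4 * B + 2 * (4 * B + theta) + 4 * B * X + 1.
have Cst0 : 0 < Cst.
  have BX : 0 <= B * X by rewrite mulr_ge0.
  by rewrite /Cst; move: (theta) theta0 => th th0; lra.
pose kap := e / (2 * Cst).
have kap0 : 0 < kap by rewrite divr_gt0// mulr_gt0.
have kapE : kap * Cst = e / 2 by rewrite /kap; field; rewrite gt_eqF.
have [mc hmc] := @choice nat nat (fun n m => (n <= m)%N /\
    2 * (2 * c * mesh T m) *
    expR ((2 * n.+2)%:R * \sum_(i < m.+2) cell_mean T zbar lambda i) <= n.+1%:R^-1)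
  (fun n => let: ex_intro2 m nm h := fine_time_grid n in ex_intro _ m (conj nm h)).
have [n1 hn1] := bad_event_small cphi theta0 fin0 (fun n => proj1 (hmc n)) kap0.
pose n := maxn n1 (Num.truncn kap^-1).
have nkap : n.+1%:R^-1 <= kap.
  rewrite -[leRHS]invrK lef_pV2 ?posrE ?invr_gt0//.
  apply: (@le_trans _ _ (Num.truncn kap^-1).+1%:R); first exact/ltW/truncnS_gt.
  by rewrite ler_nat ltnS leq_maxr.
pose m := mc n; have [nm hm] := hmc n; rewrite -/m in nm hm.
have Pbad : fine (P (bad_event phi theta m n)) <= kap by apply: hn1; exact: leq_maxl.
pose V (sigma : conf m n) := limit_prob sigma.
have V0 sigma : 0 <= V sigma by rewrite /V /limit_prob fine_ge0.
have mcfg sigma : measurable (config (@time_cell R T m) (@mark_cell R T n) Gam0 L0 sigma).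
  apply: measurable_config => //.
  - exact: measurable_time_cell.
  - exact: measurable_mark_cell.
pose er := @config_error phi theta B m n.
have er_ge0 sigma : 0 <= er sigma <= theta + 2 * B.
  rewrite /er /config_error; case: asboolP => _; apply/andP; split;
    rewrite ?addr_ge0 ?(ltW theta0)//; lra.
have sumV1 : \sum_(sigma : conf m n) V sigma <= 1.
  have := @disjoint_sum_le _ _ _ P _ _ mcfg (@config_inj _ _ _ _ _ _ _ _ _) setT xpredT measurableT.
  by rewrite probability_setT; apply.
have sumVbad : \sum_(sigma : conf m n | ~~ `[< good_config phi theta sigma >]) V sigma <= kap.
  apply: le_trans Pbad; apply: disjoint_sum_le => //.
  - by move=> s s' w; exact: config_inj.
  - exact: measurable_bad_event.
  - by move=> sigma /asboolPn bs w cw; exists sigma.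
have sumerV : \sum_(sigma : conf m n) er sigma * V sigma <= theta + 2 * B * kap.
  apply: (@le_trans _ _ (\sum_(sigma : conf m n) (theta * V sigma +
      2 * B * (if ~~ `[< good_config phi theta sigma >] then V sigma else 0)))).
    apply: ler_sum => sigma _; rewrite /er /config_error; case: ifP => _ /=.
      by rewrite mulr0 addr0.
    rewrite -mulrDl ler_wpM2r//; lra.
  rewrite big_split/= -!mulr_sumr -big_mkcond/= lerD//.
    by rewrite ler_piMr// ltW.
  by rewrite ler_wpM2l// mulr_ge0.
have sumV : 1 - \sum_(sigma : conf m n) V sigma <= 2 * X * kap.
  have h1 : 1 - \sum_(i < m.+2) cell_mean T zbar lambda i ^+ 2 <=
    \sum_(sigma : conf m n) V sigma := sum_limit_prob m n.
  have h2 : \sum_(i < m.+2) cell_mean T zbar lambda i ^+ 2 <= 2 * X / m.+1%:R.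
    exact: sum_cell_mean_sqr.
  have h3 : 2 * X / m.+1%:R <= 2 * X * kap.
    apply: ler_wpM2l; first by rewrite mulr_ge0.
    by apply: le_trans nkap; rewrite lef_pV2 ?posrE// ler_nat ltnS.
  apply: le_trans h3; apply: le_trans h2; rewrite lerBlDr -lerBlDl; exact: h1.
have [x0' x0E' bd0] := grid_expectation theta P nm pts0 phiB.
have {x0' x0E'} bd0 : `|x0 - \sum_(sigma : conf m n) phi (grid_path sigma) * V sigma| <=
    \sum_(sigma : conf m n) er sigma * V sigma + B * (1 - \sum_(sigma : conf m n) V sigma).
  by move: x0E'; rewrite x0E => -[->]; exact: bd0.
have nearS := fast_prob_near m n kap0.
near=> eps.
have eps0 : 0 < eps by near: eps; exact: nbhs_right_gt.
pose q (sigma : conf m n) := fast_prob eps sigma.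
have S2 : \sum_(sigma : conf m n) `|q sigma - V sigma| <= 2 * kap.
  apply: (@le_trans _ _ (n.+1%:R^-1 + kap)); last by rewrite mulr_natl mulr2n lerD2r.
  refine (le_trans _ (lerD hm (lexx kap))).
  by rewrite /q /V; near: eps; exact: nearS.
have [x xE bd] := grid_expectation theta Q nm (pts eps0) phiB.
rewrite /= xE /=.
have {}bd : `|x - \sum_(sigma : conf m n) phi (grid_path sigma) * q sigma| <=
    \sum_(sigma : conf m n) er sigma * q sigma +
    B * (1 - \sum_(sigma : conf m n) q sigma) by exact: bd.
set S := \sum_(sigma : conf m n) `|q sigma - V sigma| in S2.
have sums (F : conf m n -> R) (D : R) : (forall sigma, `|F sigma| <= D) ->
    `|\sum_(sigma : conf m n) F sigma * q sigma -
      \sum_(sigma : conf m n) F sigma * V sigma| <= D * S.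
  move=> FD; rewrite -sumrB mulr_sumr (le_trans (ler_norm_sum _ _ _))//.
  by apply: ler_sum => sigma _; rewrite -mulrBr normrM ler_wpM2r.
have s1 : `|\sum_(sigma : conf m n) phi (grid_path sigma) * q sigma -
   \sum_(sigma : conf m n) phi (grid_path sigma) * V sigma| <= B * S.
  by apply: sums => sigma; apply: phiB; exact: config_path_CT.
have s2 : `|\sum_(sigma : conf m n) er sigma * q sigma -
    \sum_(sigma : conf m n) er sigma * V sigma| <= (theta + 2 * B) * S.
  by apply: sums => sigma; have /andP[? ?] := er_ge0 sigma; rewrite ger0_norm.
have s3 : `|\sum_(sigma : conf m n) q sigma - \sum_(sigma : conf m n) V sigma| <= S.
  rewrite -[leRHS]mul1r; have := @sums (fun=> 1) 1.
  under eq_bigr do rewrite mul1r; under [X in _ - X]eq_bigr do rewrite mul1r.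
  by apply => _; rewrite normr1.
have s3B : B * (1 - \sum_(sigma : conf m n) q sigma) <=
    B * (1 - \sum_(sigma : conf m n) V sigma) + B * S.
  by rewrite -mulrDr; apply: ler_wpM2l => //; move: s3; rewrite ler_norml => /andP[? ?]; lra.
have sVB : B * (1 - \sum_(sigma : conf m n) V sigma) <= B * (2 * X * kap) by exact: ler_wpM2l.
have SB : (4 * B + theta) * S <= (4 * B + theta) * (2 * kap).
  by apply: ler_wpM2l => //; rewrite addr_ge0 ?mulr_ge0// ltW.
have tri : `|x0 - x| <= `|x0 - \sum_(sigma : conf m n) phi (grid_path sigma) * V sigma| +
   `|\sum_(sigma : conf m n) phi (grid_path sigma) * q sigma -
     \sum_(sigma : conf m n) phi (grid_path sigma) * V sigma| +
   `|x - \sum_(sigma : conf m n) phi (grid_path sigma) * q sigma|.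
  set a := \sum_(sigma : conf m n) _; set b := \sum_(sigma : conf m n) _.
  rewrite (_ : x0 - x = (x0 - a) - (b - a) - (x - b)); last by ring.
  by rewrite (le_trans (ler_normB _ _))// lerD2r ler_normB.
move: s2; rewrite ler_norml => /andP[_ s2'].
have te : theta = e / 8 by [].
rewrite /Cst in kapE.
by lra.
Unshelve. all: by end_near.
Qed.

Lemma random_element_total_input (dW : measure_display) (W : measurableType dW)
    (U : probability W R) (G : nat -> W -> \bar R) (M : nat -> W -> R) :
  marked_points G M -> {ae U, forall w, finite_set (arrived G T w)} ->
  random_element_CT T U (total_input G M).
Proof.
move=> pGM fin; split=> [t /andP[t0 _]|]; first exact: measurable_total_input.
apply: filterS fin => w fA; split=> [t tT|]; last exact: finite_arrivals_CT.
by rewrite (total_input_finite pGM fA tT).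
Qed.

Lemma arrivedE (dW : measure_display) (W : measurableType dW)
    (G : nat -> W -> \bar R) w :
  (forall k, 0 <= G k w)%E ->
  arrived G T w = [set k | (G k w < +oo)%E /\ `[0, T]%classic (fine (G k w))].
Proof.
move=> G0; apply/seteqP; split => k; rewrite /arrived /= in_itv/=.
  move=> kT; have Gk : (G k w < +oo)%E by rewrite (le_lt_trans kT)// ltry.
  have fk : G k w \is a fin_num by rewrite ge0_fin_numE.
  by split => //; rewrite fine_ge0//= -lee_fin fineK.
move=> [Gk /andP[_ kT]]; have fk : G k w \is a fin_num by rewrite ge0_fin_numE.
by rewrite -(fineK fk) lee_fin.
Qed.

(** The mean number of arrivals before T is at most K * K * T, for either queue. *)
Lemma bounded_mean_lty (f : R -> R) : (forall s, 0 <= s -> 0 <= f s <= K * K) ->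
  (\int[@lebesgue_measure R]_(s in `[0%R, T] `&` `[0%R, +oo[) (f s)%:E < +oo)%E.
Proof.
move=> fK; apply: (@le_lt_trans _ _ (\int[@lebesgue_measure R]_(s in `[0%R, T] `&` `[0%R, +oo[)
    (K * K)%:E)%E).
  apply: le_integralW => s [_]; rewrite /= in_itv/= andbT => s0.
  by rewrite lee_fin; case/andP: (fK s s0).
rewrite integral_cst; last by apply: measurableI; exact: measurable_itv.
rewrite (_ : _ `&` _ = `[0, T]%classic); last first.
  by apply/setIidPl => s; rewrite /= !in_itv/= andbT => /andP[].
by rewrite /= lebesgue_measure_itv/= lte_fin T0 sube0 -EFinM ltry.
Qed.

Lemma finite_arrivals_fast eps : 0 < eps ->
  {ae Q, forall w, finite_set (arrived (Gam eps) T w)}.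
Proof.
move=> e0; apply: (poisson_count_ae (pts_law e0) (B := `[0, T]%classic)).
- exact: measurable_itv.
- apply: bounded_mean_lty => s s0; have /andP[? ?] := lambdaK s0.
  by have /andP[? ?] := zK (divr_ge0 s0 (ltW e0)); rewrite mulr_ge0//= ler_pM.
- by apply: measurable_time_count => // k; case: (pts e0 k).
- move=> w; rewrite arrivedE// => k; by case: (pts e0 k).
Qed.

Lemma finite_arrivals_limit : {ae P, forall w, finite_set (arrived Gam0 T w)}.
Proof.
apply: (poisson_count_ae pts0_law (B := `[0, T]%classic `*` [set: R])).
- by apply: measurableX => //; exact: measurable_itv.
- rewrite limit_mean_rect//; apply: bounded_mean_lty => s s0.
  rewrite prob_kernel mulr1; have /andP[? ?] := lambdaK s0.
  by case/andP: zbarK => ? ?; rewrite mulr_ge0//= ler_pM.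
- apply: measurable_marked_count.
  + by move=> k; case: (pts0 k).
  + by move=> k; case: (pts0 k).
  + by apply: measurableX => //; exact: measurable_itv.
- move=> w; rewrite arrivedE; last by move=> k; case: (pts0 k).
  rewrite /marked_count; congr counting; apply/seteqP; split => k /=.
    by move=> [? []].
  by move=> [? ?].
Qed.

Theorem fixed_environment_cvg :
  cvg_in_law_CT T Q (fun eps => total_input (Gam eps) (L eps))
    P (total_input Gam0 L0).
Proof.
split.
- move=> eps e0; apply: random_element_total_input; first exact: pts.
  exact: finite_arrivals_fast.
- by apply: random_element_total_input => //; exact: finite_arrivals_limit.
- by move=> phi cphi bphi; apply: expectation_cvg => //; exact: finite_arrivals_limit.
Qed.

End fixed_environment.

(** * The random environment *)

Lemma continuous_measurable_borelRd (R : realType) (d : nat)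
    (psi : 'rV[R]_d -> R) : continuous psi ->
  measurable_fun setT (psi : borelRd R d -> R).
Proof.
move=> cpsi; apply: (measurability _ (RGenOpens.measurableE R)) => _ [_ [a [b ->] <-]].
rewrite setTI; apply: sub_sigma_algebra.
by move/continuousP: cpsi; apply; exact: interval_open.
Qed.

Lemma mean_under_bounds (R : realType) (d : nat) (pi : probability (borelRd R d) R)
    (psi : 'rV[R]_d -> R) (K : R) : continuous psi ->
  (forall x, 0 < psi x <= K) -> 0 <= mean_under pi psi <= K.
Proof.
move=> cpsi psiK; rewrite /mean_under.
have mpsi := continuous_measurable_borelRd cpsi.
have pfin : (pi setT < +oo)%E by rewrite probability_setT ltry.
have ic : pi.-integrable setT (EFin \o (fun=> K)).
  apply: measurable_bounded_integrable; [exact: measurableT|exact: pfin|by []|].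
    exists `|K|; split; first exact: num_real.
    by move=> x Kx w _ /=; exact: ltW.
apply/andP; split.
  by apply: Rintegral_ge0 => x _; case/andP: (psiK x) => /ltW.
rewrite -[leRHS]mulr1 -[X in _ * X]/(fine 1%E) -(@probability_setT _ _ _ pi).
rewrite -Rintegral_cst//; apply: le_Rintegral => //.
  apply: measurable_bounded_integrable; [exact: measurableT|exact: pfin|by []|].
    exists K; split; first exact: num_real.
    move=> x Kx w _ /=; have /andP[p0 pK] := psiK w.
    by rewrite gtr0_norm// (le_trans pK)// ltW.
by move=> x _; case/andP: (psiK x).
Qed.

(** The threshold (C / e)^(1 / kappa) makes C / t^kappa at most e. *)
Lemma cvg_of_polynomial_rate (R : realType) (f : R -> R) (l C kappa : R) :
  0 < C -> 0 < kappa ->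
  (forall t, 0 < t -> `|f t - l| <= C / (1 + t) `^ kappa) ->
  f t @[t --> +oo] --> l.
Proof.
move=> C0 kappa0 fl; apply/cvgrPdist_le => e e0; near=> t.
have t0 : 0 < t by near: t; exact: nbhs_pinfty_gt.
have tbig : (C / e) `^ kappa^-1 <= t by near: t; exact: nbhs_pinfty_ge.
have pt : 0 < (1 + t) `^ kappa by rewrite powR_gt0// addr_gt0.
rewrite distrC (le_trans (fl t t0))// ler_pdivrMr//.
rewrite mulrC -ler_pdivrMr//.
have Ce0 : 0 <= C / e by rewrite divr_ge0// ltW.
have -> : C / e = ((C / e) `^ kappa^-1) `^ kappa.
  by rewrite -powRrM mulVf ?gt_eqF// powRr1.
apply: ge0_ler_powR; first exact: ltW.
- by rewrite nnegrE powR_ge0.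
- by rewrite nnegrE; lra.
- by apply: (le_trans tbig); rewrite lerDr.
Unshelve. all: by end_near.
Qed.

Lemma measurable_path (R : realType) (dO : measure_display) (Omega : measurableType dO)
  (d : nat) (Z : R -> Omega -> borelRd R d) (psi : 'rV[R]_d -> R) (w : Omega) :
  @measurable_fun _ _ (R * Omega)%type (borelRd R d)
     (`[0, +oo[%classic `*` [set: Omega]) (fun p => Z p.1 p.2) ->
  continuous psi ->
  measurable_fun (`[0, +oo[%classic : set R) (fun u => psi (Z u w)).
Proof.
move=> mZ cpsi.
have mpsi := continuous_measurable_borelRd cpsi.
have mpair : measurable_fun (`[0, +oo[%classic : set R) (fun u : R => (u, w)).
  by apply: measurable_funTS; apply: measurable_fun_pair.
have mD : measurable (`[0, +oo[%classic `*` [set: Omega] : set (R * Omega)).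
  by apply: measurableX => //; exact: measurable_itv.
have mZw : measurable_fun (`[0, +oo[%classic : set R) (fun u => Z u w).
  refine (measurable_comp mD _ mZ mpair).
  by move=> _ [u u0 <-].
exact: (measurableT_comp mpsi mZw).
Qed.

Theorem proposition4p7 (R : realType) (dO : measure_display)
  (Omega : measurableType dO) (P : probability Omega R)
  (d : nat) (Z : R -> Omega -> borelRd R d)
  (rho0 pi : probability (borelRd R d) R)
  (Q : R -> R.-pker borelRd R d ~> borelRd R d)
  (PZ : Omega -> probability Omega R)
  (lambda : R -> R) (psi : 'rV[R]_d -> R) (K kappa : R)
  (nu : R.-pker R ~> R) (alpha c : R)
  (Gam : R -> nat -> Omega -> \bar R) (L : R -> nat -> Omega -> R)
  (Gam0 : nat -> Omega -> \bar R) (L0 : nat -> Omega -> R) (T : R)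
  (Z_meas : @measurable_fun _ _ (R * Omega)%type (borelRd R d)
     (`[0, +oo[%classic `*` [set: Omega]) (fun p => Z p.1 p.2))
  (Z_init : forall A : set (borelRd R d), measurable A ->
     P (Z 0 @^-1` A) = rho0 A)
  (Z_trans : transition_laws P Z rho0 Q)
  (pi_inv : unique_invariant_law Q pi)
  (kappa_gt0 : 0 < kappa)
  (Z_erg : strongly_ergodic P Z pi psi kappa)
  (PZ_cond : regular_conditional_probability P (process_events `[0, +oo[ Z) PZ)
  (K_gt0 : 0 < K)
  (lambda_cont : {within `[0, +oo[, continuous lambda})
  (lambda_bd : forall s, 0 <= s -> 0 <= lambda s <= K)
  (psi_cont : continuous psi)
  (psi_bd : forall z, 0 < psi z <= K)
  (psi_lip : lipschitz psi)
  (nu_pos : forall s, 0 <= s -> nu s `[0, +oo[%classic = 1%E)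
  (alpha_gt0 : 0 < alpha) (c_gt0 : 0 < c)
  (Fbar_tail : forall r s, 0 < r -> 0 < s ->
     ccdf_ker nu s r <= c * Num.min (r `^ (- alpha)) 1)
  (Fbar_lip : forall r s t, 0 < r -> 0 < s -> s < t ->
     `|ccdf_ker nu s r - ccdf_ker nu t r| <=
     c * (1 + r) `^ (-1 - alpha) * (t - s))
  (pts : forall eps, 0 < eps -> marked_points (Gam eps) (L eps))
  (pts_law : {ae P, forall w, forall eps, 0 < eps ->
     poisson_random_measure (PZ w) (arrival_mean lambda psi (Z ^~ w) eps)
       (time_count (Gam eps)) /\
     conditional_marks (PZ w) nu (Gam eps) (L eps)})
  (pts0 : marked_points Gam0 L0)
  (pts0_law : poisson_random_measure P
     (limit_mean lambda nu (mean_under pi psi)) (marked_count Gam0 L0))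
  (N_indep : forall eps, 0 < eps ->
     independent_processes P `[0, +oo[ `[0, +oo[
       (active_jobs Gam0 L0) (active_jobs (Gam eps) (L eps)))
  (T_gt0 : 0 < T) :
  {ae P, forall w,
     cvg_in_law_CT T (PZ w) (fun eps => total_input (Gam eps) (L eps))
       P (total_input Gam0 L0)}.

Proof.
have [C [C0 erg]] := Z_erg.
have zbarK := mean_under_bounds pi psi_cont psi_bd.
near=> w.
have law : forall eps, 0 < eps ->
    poisson_random_measure (PZ w) (arrival_mean lambda psi (Z ^~ w) eps)
      (time_count (Gam eps)) /\ conditional_marks (PZ w) nu (Gam eps) (L eps).
  by near: w; exact: pts_law.
have avg : forall t : R, 0 < t ->
    `| t^-1 * (\int[lebesgue_measure]_(u in `[0, t]) psi (Z u w))
          - mean_under pi psi | <= C w / (1 + t) `^ kappa.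
  by near: w; exact: erg.
apply: (@fixed_environment_cvg R dO dO Omega Omega (PZ w) P lambda
  (fun u => psi (Z u w)) K c alpha (mean_under pi psi) T nu) => //.
- exact: measurable_path Z_meas psi_cont.
- by move=> u _; have /andP[p0 ->] := psi_bd (Z u w); rewrite ltW.
- exact: cvg_of_polynomial_rate (C0 w) kappa_gt0 avg.
- by move=> eps e0; case: (law eps e0).
- by move=> eps e0; case: (law eps e0).
Unshelve. all: by end_near.
Qed.
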